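(* Let $\boldsymbol\alpha$ be an arbitrary sequence in $\mathbb D$, $\mu$ a measure on $\mathbb T$, $(\phi_n)_{n\ge0}$ the corresponding ORF and $(\chi_n)_{n\ge0}$ the ORF associated with the sequence $(\alpha_1,\hat\alpha_2,\alpha_3,\hat\alpha_4,\dots)$. Let $\mathcal A=\mathcal A(\boldsymbol\alpha)$ and $\mathcal C=\mathcal C(\boldsymbol a)$ with $\boldsymbol a=\mathcal S_{\boldsymbol\alpha}(\mu)$. For $n\ge1$ let $\mathcal U^{(n)}=\tilde\zeta_{\mathcal A_n}(\mathcal C_n)$. Then: 1. The zeros of $\phi_n$ are the eigenvalues of $\mathcal U^{(n)}$, which have geometric multiplicity 1. If $\lambda$ is a zero of $\phi_n$, the related left and right eigenvectors of $\mathcal U^{(n)}$ are spanned by $X_n(\lambda)$ and $Y_n(\lambda)^T$ respectively, where $$X_n=B^e_{[\frac{n-1}2]}\begin{pmatrix}\chi_0&\cdots&\chi_{n-1}\end{pmatrix},\qquad Y_n=B^o_{[\frac n2]}\begin{pmatrix}\chi_{0*}&\cdots&\chi_{n-1*}\end{pmatrix}.$$ 2. $\phi_n=\dfrac{p_n}{\pi_n}$ with $p_n$ proportional to the characteristic polynomial of $\mathcal U^{(n)}$.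
   Context: $\mathbb T$ is the unit circle, $\mathbb D$ the open unit disk. A measure on $\mathbb T$ is a probability Borel measure $\mu$ on $\mathbb T$ with infinite support. $L^2_\mu$ carries the inner product $\langle f,g\rangle_\mu=\int\overline{f}\,g\,d\mu$. ORF. Let $\boldsymbol\alpha=(\alpha_n)_{n\ge1}$ be a sequence in $\mathbb D$ and set $\alpha_0=0$. For $n\ge0$ let $\varpi_n(z)=1-\overline{\alpha_n}z$, $\varpi_n^*(z)=z-\alpha_n$, $\zeta_n=\varpi_n^*/\varpi_n$; $\pi_n=\varpi_1\cdots\varpi_n$. Let $B_0=1$, $B_n=\zeta_1\cdots\zeta_n$, $f_*(z)=\overline{f(1/\overline z)}$ and $\hat z=1/\overline z$ (with $\hat 0=\infty$). The orthogonal rational functions (ORF) $(\phi_n)_{n\ge0}$ of $\mu$ associated with $\boldsymbol\alpha$ are the result of orthonormalizing $(B_n)_{n\ge0}$ in $L^2_\mu$ (so $\phi_0,\dots,\phi_n$ is an orthonormal basis of $\operatorname{span}\{B_0,\dots,B_n\}$ for every $n$), with unimodular factors chosen so that $\phi_0=1$ and, with $\phi_n^*=B_n\phi_{n*}$, $$\begin{pmatrix}\phi_n\\ \phi_n^*\end{pmatrix}=e_n\frac{\varpi_{n-1}}{\varpi_n}\begin{pmatrix}1&a_n\\ \overline{a_n}&1\end{pmatrix}\begin{pmatrix}\zeta_{n-1}\phi_{n-1}\\ \phi_{n-1}^*\end{pmatrix},\quad e_n=\sqrt{\frac{\varpi_n(\alpha_n)}{\varpi_{n-1}(\alpha_{n-1})}\frac1{1-|a_n|^2}},\quad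 n\ge1,$$ for some $a_n\in\mathbb D$. This normalization exists and both $(\phi_n)$ and $\boldsymbol a=(a_n)_{n\ge1}$ are then uniquely determined; one writes $\boldsymbol a=\mathcal S_{\boldsymbol\alpha}(\mu)$. One has $\phi_n=p_n/\pi_n$ with $p_n$ a polynomial of degree $n$; the zeros of $\phi_n$ are those of $p_n$ and lie in $\mathbb D$. Put $B_0^o=B_0^e=1$, $B_n^o=\zeta_1\zeta_3\cdots\zeta_{2n-1}$, $B_n^e=\zeta_2\zeta_4\cdots\zeta_{2n}$. The ORF $(\chi_n)_{n\ge0}$ associated with $(\alpha_1,\hat\alpha_2,\alpha_3,\hat\alpha_4,\dots)$ are $\chi_{2n}=B^e_{n*}\phi_{2n}^*$, $\chi_{2n+1}=B^e_{n*}\phi_{2n+1}$, $n\ge0$. $[x]$ denotes the integer part of $x$. The vectors $X_n,Y_n$ are vectors of rational functions (after cancellation) with poles only outside $\overline{\mathbb D}$, so they can be evaluated at points of $\mathbb D$. Matrices. $\mathcal A(\boldsymbol\alpha)=\operatorname{diag}(\alpha_0,\alpha_1,\alpha_2,\dots)$. With $\rho_n=\sqrt{1-|a_n|^2}$ and $\Theta_n=\begin{pmatrix}-a_n&\rho_n\\ \rho_n&\overline{a_n}\end{pmatrix}$, $\mathcal C(\boldsymbol a)=\mathcal C_o\mathcal C_e$ is the five-diagonal unitary matrix with $\mathcal C_o=\Theta_1\oplus\Theta_3\oplus\Theta_5\oplus\cdots$ and $\mathcal C_e=1\oplus\Theta_2\oplus\Theta_4\oplus\cdots$ (here $1$ is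 a $1\times1$ block). A subscript ${}_n$ on a matrix denotes its principal submatrix of order $n$ (first $n$ rows and columns). A left eigenvector of $M$ with eigenvalue $\lambda$ is a nonzero row vector $x$ with $xM=\lambda x$; right eigenvectors are ordinary (column) eigenvectors. Operator Möbius transformation. For operators (matrices) $A,T$ with $\|A\|<1$, $\|T\|\le1$, set $\eta_A=\sqrt{1-AA^\dag}$ and $\tilde\zeta_A(T)=\eta_A^{-1}(T+A)(1+A^\dag T)^{-1}\eta_{A^\dag}$. *)

(* Defs.v *)
From HB Require Import structures.
From mathcomp Require Import all_boot all_order all_algebra.
From mathcomp Require Import generic_quotient complex spectral sesquilinear.
From mathcomp Require Import all_classical all_reals all_analysis.

Set Implicit Arguments.
Unset Strict Implicit.
Unset Printing Implicit Defensive.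

Import Order.TTheory GRing.Theory Num.Theory.
Import numFieldNormedType.Exports.

Local Open Scope classical_set_scope.
Local Open Scope sesquilinear_scope.
Local Open Scope ring_scope.

Definition unit_circle (R : realType) : set (R[i] : numFieldType) :=
  [set z | `|z| = 1].
Arguments unit_circle R : clear implicits.

Definition circle (R : realType) := set_type (unit_circle R).

HB.instance Definition _ (R : realType) :=
  Topological.copy (circle R) (set_type (unit_circle R)).

Lemma unit_circle1 (R : realType) : (1 : R[i]) \in unit_circle R.
Proof. by rewrite inE /unit_circle /= normr1. Qed.

HB.instance Definition _ (R : realType) :=
  isPointed.Build (circle R) (exist _ (1 : R[i]) (unit_circle1 R)).

Definition borel_circle (R : realType) := g_sigma_algebraType (@open (circle R)).

Definition circle_val (R : realType) (t : borel_circle R) : R[i] :=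
  set_val (t : set_type (unit_circle R)).

Definition mu_support (R : realType) (mu : probability (borel_circle R) R) :
    set (circle R) :=
  [set t | forall V : set (circle R), open V -> V t -> (0 < mu V)%E].

Section RationalFunctions.
Variable R : realType.
Local Notation C := R[i].

Definition ratfun := {fraction {poly C}}.

Definition polyf (p : {poly C}) : ratfun := @FracField.tofrac {poly C} p.

Definition constf (c : C) : ratfun := polyf c%:P.

(* [repr] picks an arbitrary representative of a fraction: dividing by the gcd
   makes numerator and denominator coprime, so that evaluation and zeros are
   those of the rational function after cancellation. *)
Definition rnum (f : ratfun) : {poly C} :=
  let x : {ratio {poly C}} := repr f in (frac x).1 %/ gcdp (frac x).1 (frac x).2.

Definition rden (f : ratfun) : {poly C} :=
  let x : {ratio {poly C}} := repr f in (frac x).2 %/ gcdp (frac x).1 (frac x).2.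

(* Junk value 0 at the poles. *)
Definition reval (f : ratfun) (z : C) : C := (rnum f).[z] / (rden f).[z].

(* Defined through the numerator, so that poles do not count as zeros. *)
Definition rzero (f : ratfun) (z : C) : bool := root (rnum f) z.

Definition polystar (p : {poly C}) : ratfun :=
  \sum_(i < size p) constf (p`_i)^* / polyf 'X ^+ i.

(* f_*(z) = conj (f (1 / conj z)) *)
Definition rstar (f : ratfun) : ratfun := polystar (rnum f) / polystar (rden f).

Definition in_span (f : nat -> ratfun) (n : nat) (g : ratfun) : Prop :=
  exists c : nat -> C, g = \sum_(k < n.+1) constf (c k) * f k.

Definition inner (mu : probability (borel_circle R) R) (f g : ratfun) : C :=
  let h t := (reval f (circle_val t))^* * reval g (circle_val t) in
  Complex (\int[mu]_(t in [set: borel_circle R]) complex.Re (h t))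
          (\int[mu]_(t in [set: borel_circle R]) complex.Im (h t)).

End RationalFunctions.

Section ORF.
Variable R : realType.
Local Notation C := R[i].
Local Notation ratfun := (ratfun R).
Implicit Types (alpha a : nat -> C) (phi : nat -> ratfun).

Definition varpi alpha n : {poly C} := 1 - (alpha n)^* *: 'X.
Definition varpistar alpha n : {poly C} := 'X - (alpha n)%:P.
Definition zeta alpha n : ratfun :=
  polyf (varpistar alpha n) / polyf (varpi alpha n).
Definition pi_ alpha n : {poly C} := \prod_(1 <= k < n.+1) varpi alpha k.
Definition B alpha n : ratfun := \prod_(1 <= k < n.+1) zeta alpha k.
Definition Bo alpha n : ratfun := \prod_(k < n) zeta alpha k.*2.+1.
Definition Be alpha n : ratfun := \prod_(k < n) zeta alpha k.*2.+2.

(* f^* = B_n f_*, the superstar depending on n. *)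
Definition superstar alpha n (f : ratfun) : ratfun := B alpha n * rstar f.

Definition e_ alpha a n : C :=
  sqrtC ((varpi alpha n).[alpha n] / (varpi alpha n.-1).[alpha n.-1]
         * (1 / (1 - `|a n| ^+ 2))).

(* [is_ORF mu alpha phi a]: phi is the sequence of orthogonal rational functions
   of mu associated with alpha, and a = S_alpha(mu).  Only the terms a_n with
   n >= 1 are constrained. *)
Record is_ORF (mu : probability (borel_circle R) R) alpha phi a : Prop := IsORF {
  ORF_orthonormal : forall i j, inner mu (phi i) (phi j) = (i == j)%:R;
  ORF_span : forall n f, in_span phi n f <-> in_span (B alpha) n f;
  ORF_0 : phi 0%N = 1;
  ORF_param : forall n, (0 < n)%N -> `|a n| < 1;
  ORF_rec : forall n, (0 < n)%N ->
    phi n = constf (e_ alpha a n)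
      * (polyf (varpi alpha n.-1) / polyf (varpi alpha n))
      * (zeta alpha n.-1 * phi n.-1
         + constf (a n) * superstar alpha n.-1 (phi n.-1));
  ORF_rec_star : forall n, (0 < n)%N ->
    superstar alpha n (phi n) = constf (e_ alpha a n)
      * (polyf (varpi alpha n.-1) / polyf (varpi alpha n))
      * (constf (a n)^* * (zeta alpha n.-1 * phi n.-1)
         + superstar alpha n.-1 (phi n.-1))
}.

(* Orthogonal rational functions associated with the sequence
   alpha_1, 1 / conj alpha_2, alpha_3, 1 / conj alpha_4, ... *)
Definition chi alpha phi n : ratfun :=
  rstar (Be alpha n./2) * (if odd n then phi n else superstar alpha n (phi n)).

Definition Xvec alpha phi n : 'rV[ratfun]_n :=
  \row_(j < n) (Be alpha n.-1./2 * chi alpha phi j).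

Definition Yvec alpha phi n : 'rV[ratfun]_n :=
  \row_(j < n) (Bo alpha n./2 * rstar (chi alpha phi j)).

Definition rveval n (v : 'rV[ratfun]_n) (z : C) : 'rV[C]_n :=
  map_mx (fun f => reval f z) v.

End ORF.

Section Matrices.
Variable R : realType.
Local Notation C := R[i].
Implicit Types (alpha a : nat -> C).

(* Infinite matrices are functions nat -> nat -> C, indexed from 0. *)
Definition principal (M : nat -> nat -> C) n : 'M[C]_n :=
  \matrix_(i < n, j < n) M i j.

Definition Amx alpha (i j : nat) : C := if i == j then alpha i else 0.

Definition rho a n : C := sqrtC (1 - `|a n| ^+ 2).

(* Theta_n occupies rows and columns n - 1 and n of Co (n odd) or Ce (n even). *)
Definition Theta a n : 'M[C]_2 :=
  \matrix_(r < 2, s < 2)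
    nth 0 (nth [::] [:: [:: - a n; rho a n]; [:: rho a n; (a n)^*]] r) s.

(* T 0 (+) T 1 (+) T 2 (+) ... *)
Definition block_sum (T : nat -> 'M[C]_2) (i j : nat) : C :=
  if i./2 == j./2 then T i./2 (inord (odd i)) (inord (odd j)) else 0.

Definition Co a : nat -> nat -> C := block_sum (fun k => Theta a k.*2.+1).

Definition Ce a (i j : nat) : C :=
  match i, j with
  | 0, 0 => 1
  | i'.+1, j'.+1 => block_sum (fun k => Theta a k.*2.+2) i' j'
  | _, _ => 0
  end.

(* The product Co Ce: row i of Co vanishes beyond column i + 1. *)
Definition Cmx a (i j : nat) : C := \sum_(k < i.+2) Co a i k * Ce a k j.

(* Square root of a positive semidefinite matrix, by functional calculus. *)
Definition mxsqrt n (M : 'M[C]_n) : 'M[C]_n :=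
  invmx (spectralmx M) *m diag_mx (map_mx sqrtC (spectral_diag M))
    *m spectralmx M.

Definition eta n (A : 'M[C]_n) : 'M[C]_n := mxsqrt (1%:M - A *m A ^t*).

(* The operator Moebius transformation of T by A, meant for A of norm < 1 and T
   of norm <= 1. *)
Definition mobius n (A T : 'M[C]_n) : 'M[C]_n :=
  invmx (eta A) *m (T + A) *m invmx (1%:M + A ^t* *m T) *m eta (A ^t*).

Definition Umx alpha a n : 'M[C]_n :=
  mobius (principal (Amx alpha) n) (principal (Cmx a) n).

End Matrices.

(* Main.v *)
(* With the poles and normalizing constants absorbed into
     u_n = phi_n varpi_n / eta_n,   u*_n = phi*_n varpi_n / eta_n,
   eta_n = sqrt(1 - |alpha_n|^2), the recurrence of the ORF reads
     (zeta_(n-1) u_(n-1), u*_n) = (u*_(n-1), u_n) Theta_n.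
   Multiplying alternately by the blocks of C_o and C_e therefore turns the row
   of entries u*_0, u_1, u*_2, ... (suitably weighted by products of zeta_k) into
   its multiple by diag(zeta_k), up to one defect proportional to u_n caused by
   the truncation.  Undoing the operator Moebius transformation, a left (right)
   eigenvector of U for l is the same as a row w with w C_o C_e = w diag(zeta_k(l))
   (w C_e C_o = w diag(zeta_k(l))); solving this equation coordinate by coordinate
   gives a one-parameter family of candidates, because u*_k has no zero in the
   disk.  The characteristic polynomial is det(diag(zeta_k) - C_n) up to simple
   factors; stripping off the unitary one of the two block matrices leaves a
   tridiagonal matrix, and the weighted row evaluates its determinant as a
   constant times u_n. *)
From HB Require Import structures.
Require Import Defs.
From mathcomp Require Import all_boot all_order all_algebra.
From mathcomp Require Import perm generic_quotient complex spectral sesquilinear.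
From mathcomp Require Import all_classical all_reals all_analysis.
From mathcomp Require Import ring zify.

Set Implicit Arguments.
Unset Strict Implicit.
Unset Printing Implicit Defensive.

Import Order.TTheory GRing.Theory Num.Theory.
Local Open Scope classical_set_scope.
Local Open Scope sesquilinear_scope.
Local Open Scope ring_scope.

(** * Alternating products of 2 x 2 block matrices *)

Section BlockDiagonal.
Variable K : fieldType.
Implicit Types (a ab r : nat -> K) (w : nat -> K) (b : bool).

Definition starred b j := odd j == b.

(* With ab 0 = 1 and r 0 = 0 these are the entries of C_o (b = false) and of C_e
   (b = true): the blocks Theta_(j+1) sit on rows and columns j, j + 1 for the
   starred j. *)
Definition block_entry a ab r b i j : K :=
  (i == j)%:R * (if starred b j then - a j.+1 else ab j)
  + (i == j.+1)%:R * (if starred b j then r j.+1 else 0)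
  + (i.+1 == j)%:R * (if starred b j then 0 else r j).

Definition blockmx a ab r b n : 'M[K]_n :=
  \matrix_(i, j) block_entry a ab r b i j.

Definition block_act a ab r b w j : K :=
  if starred b j then - a j.+1 * w j + r j.+1 * w j.+1
  else ab j * w j + r j * w j.-1.

Definition nat_of_row n (W : 'rV[K]_n) k : K :=
  if insub k is Some i then W 0 i else 0.

Definition row_of_nat n w : 'rV[K]_n := \row_i w i.

Definition trunc n w k := if (k < n)%N then w k else 0.

Lemma nat_of_rowK n (W : 'rV[K]_n) : row_of_nat n (nat_of_row W) = W.
Proof. by apply/rowP=> i; rewrite mxE /nat_of_row valK. Qed.

Lemma nat_of_row_ge n (W : 'rV[K]_n) k : (n <= k)%N -> nat_of_row W k = 0.
Proof. by move=> nk; rewrite /nat_of_row insubF // ltnNge nk. Qed.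

Lemma row_of_nat_trunc n w : row_of_nat n (trunc n w) = row_of_nat n w.
Proof. by apply/rowP=> i; rewrite !mxE /trunc ltn_ord. Qed.

Lemma trunc_ge n w : trunc n w n = 0.
Proof. by rewrite /trunc ltnn. Qed.

Lemma sum_ord_delta n w k (F : nat -> bool) :
  (forall i, F i = (i == k)) ->
  \sum_(i < n) w i * (F i)%:R = trunc n w k.
Proof.
move=> FE; rewrite /trunc; case: ltnP => [kn|nk].
  rewrite (bigD1 (Ordinal kn)) //= FE eqxx mulr1 big1 ?addr0 // => i.
  by rewrite -val_eqE /= FE => /negbTE ->; rewrite mulr0.
apply: big1 => i _; rewrite FE; case: eqP => [ik|_]; last by rewrite mulr0.
by move: (ltn_ord i); rewrite ik ltnNge nk.
Qed.

Lemma mul_row_blockmx a ab r b n w : r 0 = 0 -> w n = 0 ->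
  row_of_nat n w *m blockmx a ab r b n = row_of_nat n (block_act a ab r b w).
Proof.
move=> r0 wn; apply/rowP=> j; rewrite !mxE.
under eq_bigr => i _ do rewrite !mxE /block_entry !mulrDr !mulrA.
rewrite !big_split /= -!mulr_suml.
rewrite (@sum_ord_delta n w j (fun i => i == j)) //.
rewrite (@sum_ord_delta n w j.+1 (fun i => i == j.+1)) //.
have -> : trunc n w j.+1 = w j.+1.
  rewrite /trunc; case: ltnP => // nj.
  by have -> : j.+1 = n by apply/eqP; rewrite eqn_leq nj ltn_ord.
have -> : trunc n w j = w j by rewrite /trunc ltn_ord.
have -> : (\sum_(i < n) w i * (i.+1 == j)%:R)
    * (if starred b j then 0 else r j) = if starred b j then 0 else r j * w j.-1.
  case: ifP => _; first by rewrite mulr0.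
  case: j => [[|j] jn] /=; first by rewrite r0 mulr0 mul0r.
  rewrite (@sum_ord_delta n w j (fun i => i.+1 == j.+1)) //.
  by rewrite /trunc ltnW // mulrC.
by rewrite /block_act; case: ifP => _; ring.
Qed.

Lemma blockmx_tr a ab r b n : (blockmx a ab r b n)^T = blockmx a ab r b n.
Proof.
apply/matrixP=> i j; have [-> //|ne] := eqVneq i j; first by rewrite mxE.
have sh (k l : nat) : (k == l.+1)%:R * (if starred b l then r l.+1 else 0)
    = (l.+1 == k)%:R * (if starred b k then 0 else r k).
  rewrite eq_sym; case: eqP => [<-|_]; last by rewrite !mul0r.
  by rewrite /starred /=; case: (odd l) (b) => [] [].
rewrite !mxE /block_entry -!(inj_eq val_inj) /= in ne *.
by rewrite (negbTE ne) eq_sym (negbTE ne) !mul0r !add0r !sh addrC.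
Qed.

Lemma blockmx_subdiag a ab r b n (i j : 'I_n) : i = j.+1 :> nat ->
  blockmx a ab r b n i j = if starred b j then r j.+1 else 0.
Proof.
move=> ij; rewrite mxE /block_entry ij eqxx mul1r [(j.+1 == j)%N]gtn_eqF //.
by rewrite [(j.+2 == j)%N]gtn_eqF // !mul0r add0r addr0.
Qed.

Lemma blockmx_low a ab r b n (i j : 'I_n) : (j.+1 < i)%N ->
  blockmx a ab r b n i j = 0.
Proof.
move=> ij; rewrite mxE /block_entry !gtn_eqF ?mul0r ?addr0 //; lia.
Qed.

Lemma row_act_inj m n (A A' : 'M[K]_(m, n)) :
  (forall W : 'rV_m, W *m A = W *m A') -> A = A'.
Proof. by move=> AA; apply/row_matrixP=> i; rewrite !rowE AA. Qed.

End BlockDiagonal.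

Lemma map_blockmx (K L : fieldType) (f : {rmorphism K -> L}) (a ab r : nat -> K)
    b n :
  map_mx f (blockmx a ab r b n) = blockmx (f \o a) (f \o ab) (f \o r) b n.
Proof.
apply/matrixP=> i j; rewrite !mxE /block_entry !rmorphD !rmorphM !rmorph_nat.
by case: ifP => _; rewrite ?rmorphN ?rmorph0.
Qed.

(* For an upper Hessenberg matrix, a row vector that it maps to a multiple of
   the last basis vector gives the determinant: substituting it for the first
   row leaves a triangular minor. *)
Lemma det_hessenberg (K : comNzRingType) m (N : 'M[K]_m.+1) (t : 'rV_m.+1) d :
  (forall i j : 'I_m.+1, (j.+1 < i)%N -> N i j = 0) ->
  t *m N = d *: delta_mx 0 ord_max ->
  t 0 0 * \det N
  = d * (-1) ^+ m * \prod_(j < m) N (lift ord0 j) (lift ord_max j).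
Proof.
move=> Nlow tN.
pose T : 'M[K]_m.+1 := \matrix_(i, j) if i == 0 then t 0 j else (i == j)%:R.
have trigT : is_trig_mx T^T.
  apply/is_trig_mxP=> i j ij; rewrite !mxE -val_eqE /=.
  by rewrite (gtn_eqF (leq_ltn_trans (leq0n i) ij)) -val_eqE /= gtn_eqF.
have detT : \det T = t 0 0.
  rewrite -det_tr (det_trig trigT) big_ord_recl !mxE eqxx big1 ?mulr1 // => i _.
  by rewrite !mxE eqxx.
have rowT i j : (T *m N) i j = if i == 0 then (t *m N) 0 j else N i j.
  rewrite !mxE; case: eqP => [->|/eqP ne].
    by apply: eq_bigr => k _; rewrite mxE eqxx.
  rewrite (bigD1 i) //= mxE (negbTE ne) eqxx mul1r big1 ?addr0 // => k ki.
  by rewrite mxE (negbTE ne) eq_sym (negbTE ki) mul0r.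
rewrite -detT -det_mulmx (expand_det_row _ ord0) (bigD1 ord_max) //=.
rewrite [X in _ + X]big1 ?addr0 => [|j jmax]; last first.
  by rewrite rowT eqxx tN !mxE (negbTE jmax) andbF mulr0 mul0r.
rewrite rowT eqxx tN !mxE !eqxx mulr1 -mulrA /cofactor add0n -det_tr.
rewrite det_trig; last first.
  apply/is_trig_mxP=> i j ij; rewrite 3!mxE.
  rewrite rowT; case: eqP => [/(congr1 val)//|_]; apply: Nlow.
  by rewrite /= /bump [(m <= i)%N]leqNgt ltn_ord add0n add1n ltnS.
congr (_ * (_ * _)); apply: eq_bigr => j _.
by rewrite 3!mxE rowT; case: eqP => [/(congr1 val)//|_].
Qed.

Section Transfer.
Variables (K : fieldType) (a ab r : nat -> K).
Hypotheses (ab0 : ab 0 = 1) (a0 : a 0 = 1) (r0 : r 0 = 0).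
Hypothesis r_neq0 : forall k, r k.+1 != 0.
Hypothesis unitary : forall k, r k ^+ 2 + a k * ab k = 1.
Variables (z u us : nat -> K).
Hypotheses (u0 : u 0 = 1) (us0 : us 0 = 1).
Hypothesis zetaM : forall k, z k * u k = - a k.+1 * us k + r k.+1 * u k.+1.
Hypothesis usS : forall k, us k.+1 = r k.+1 * us k + ab k.+1 * u k.+1.
Implicit Types (b : bool) (w : nat -> K).

Local Notation E := (blockmx a ab r).
Local Notation act := (block_act a ab r).

Definition starred_prod b n j : K := \prod_(j.+1 <= l < n | starred b l) z l.

(* null_vec is the row announced in the header, half_null_vec its product with
   the first of the two block matrices. *)
Definition null_vec b n j : K :=
  starred_prod b n j * (if starred b j then us j else u j).

Definition half_null_vec b n j : K :=
  starred_prod b n j * (if starred b j then z j * u j else us j).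

Lemma starred_prod_last b n : starred_prod b n.+1 n = 1.
Proof. by rewrite /starred_prod big_geq. Qed.

Lemma starred_prodSl b n j : (j.+1 < n)%N ->
  starred_prod b n j = (if starred b j.+1 then z j.+1 else 1) * starred_prod b n j.+1.
Proof.
move=> jn; rewrite /starred_prod big_ltn_cond //.
by case: ifP => _; rewrite ?mul1r.
Qed.

Lemma starred_prodSr b n j : (j < n)%N ->
  starred_prod b n.+1 j = (if starred b n then z n else 1) * starred_prod b n j.
Proof.
move=> jn; rewrite /starred_prod big_mkcond big_nat_recr //= -big_mkcond /=.
by rewrite mulrC; case: ifP => _.
Qed.

Lemma starredS b j : starred b j.+1 = ~~ starred b j.
Proof. by rewrite /starred /=; case: (odd j) b => [] []. Qed.

Lemma starredN b j : starred (~~ b) j = ~~ starred b j.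
Proof. by rewrite /starred; case: (odd j) b => [] []. Qed.

Lemma act_starred b w j : starred b j ->
  act b w j = - a j.+1 * w j + r j.+1 * w j.+1.
Proof. by rewrite /block_act => ->. Qed.

Lemma act_starredS b w j : starred b j ->
  act b w j.+1 = ab j.+1 * w j.+1 + r j.+1 * w j.
Proof. by rewrite /block_act starredS => ->. Qed.

Lemma act_unstarred0 b w : ~~ starred b 0 -> act b w 0 = w 0.
Proof. by rewrite /block_act => /negbTE ->; rewrite ab0 r0; ring. Qed.

Lemma act_null_vec b n j : (j < n)%N ->
  act b (trunc n (null_vec b n)) j
  = half_null_vec b n j - (if (j.+1 == n) && starred b j then r n * u n else 0).
Proof.
move=> jn; have [sj|sj] := boolP (starred b j).
  rewrite act_starred // /trunc jn andbT /half_null_vec /null_vec sj.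
  case: (ltnP j.+1 n) => [jn1|nj1].
    rewrite (ltn_eqF jn1) starredS sj /= starred_prodSl // starredS sj /= zetaM subr0.
    by ring.
  have nE : n = j.+1 by apply/eqP; rewrite eqn_leq nj1 jn.
  rewrite nE eqxx starred_prod_last zetaM; ring.
rewrite andbF subr0 /half_null_vec (negbTE sj); case: j jn sj => [|j] jn sj.
  by rewrite act_unstarred0 // /trunc jn /null_vec (negbTE sj) u0 us0.
have sj' : starred b j by rewrite starredS in sj; apply: negbNE.
rewrite act_starredS // /trunc jn ltnW // /null_vec (negbTE sj) sj'.
by rewrite (starred_prodSl b jn) (negbTE sj) usS; ring.
Qed.

Lemma act_half_null_vec b n j : (j < n)%N ->
  act (~~ b) (trunc n (half_null_vec b n)) j
  = z j * null_vec b n j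
    - (if (j.+1 == n) && ~~ starred b j then r n * u n else 0).
Proof.
move=> jn; have [sj|sj] := boolP (starred b j).
  rewrite andbF subr0 /null_vec sj; case: j jn sj => [|j] jn sj.
    rewrite act_unstarred0 ?starredN ?sj // /trunc jn /half_null_vec sj u0 us0; ring.
  have sj' : ~~ starred b j by rewrite starredS in sj.
  rewrite act_starredS ?starredN // /trunc jn ltnW // /half_null_vec sj (negbTE sj').
  by rewrite (starred_prodSl b jn) sj usS; ring.
rewrite act_starred ?starredN // /trunc jn andbT /half_null_vec /null_vec (negbTE sj).
case: (ltnP j.+1 n) => [jn1|nj1].
  rewrite (ltn_eqF jn1) starredS sj /= starred_prodSl // starredS sj /= subr0.
  transitivity (starred_prod b n j.+1 * z j.+1 * (- a j.+1 * us j + r j.+1 * u j.+1));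
    first by ring.
  by rewrite -zetaM; ring.
have nE : n = j.+1 by apply/eqP; rewrite eqn_leq nj1 jn.
rewrite nE eqxx starred_prod_last !mul1r zetaM; ring.
Qed.

(* Forward induction: the first k + 1 coordinates of a null vector are
   determined up to a scalar.  At a starred index z may vanish, and it is
   us <> 0 that allows the scalar to be renormalized. *)
Lemma null_vector_prefix b n w k : (forall j, us j != 0) ->
  (forall j, (j < n)%N -> act (~~ b) (trunc n (act b w)) j = z j * w j) ->
  (k < n)%N ->
  exists c, (forall j, (j <= k)%N -> w j = c * null_vec b k.+1 j)
    /\ act b w k = c * half_null_vec b k.+1 k.
Proof.
move=> us_neq0 nullw; elim: k => [|k IHk] kn.
  exists (w 0); rewrite /null_vec /half_null_vec starred_prod_last u0 us0; split.
    by case=> // _; rewrite starred_prod_last u0 us0; case: ifP => _; ring.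
  have [s0|s0] := boolP (starred b 0); last by rewrite act_unstarred0 //; ring.
  have := nullw 0 kn; rewrite (@act_unstarred0 (~~ b)) ?starredN ?s0 // /trunc kn => ->.
  ring.
have [c [wE tE]] := IHk (ltnW kn).
have wk := wE k (leqnn k); move: wk tE; rewrite /null_vec /half_null_vec starred_prod_last !mul1r.
have [sk|sk] := boolP (starred b k) => wk tE.
  exists c; have wk1 : w k.+1 = c * u k.+1.
    apply: (mulfI (r_neq0 k)); apply: (addrI (- a k.+1 * w k)).
    rewrite -(@act_starred b) // tE wk zetaM; ring.
  split=> [j|]; last first.
    by rewrite act_starredS // starredS sk /= starred_prod_last wk wk1 usS; ring.
  rewrite leq_eqVlt => /orP[/eqP ->|jk].
    by rewrite starred_prod_last starredS sk /= mul1r.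
  by rewrite wE // /null_vec (starred_prodSr b jk) starredS sk /= mul1r.
have := nullw k.+1 kn; have := nullw k (ltnW kn).
rewrite (@act_starred (~~ b)) ?(@act_starredS (~~ b)) ?starredN //.
rewrite /trunc kn ltnW // tE wk => e1 e2.
have tk1 : act b w k.+1 = c * u k.+1.
  apply: (mulfI (r_neq0 k)); apply: (addrI (- a k.+1 * (c * us k))).
  rewrite e1 mulrCA zetaM; ring.
have zw : z k.+1 * w k.+1 = c * us k.+1 by rewrite -e2 tk1 usS; ring.
exists (w k.+1 / us k.+1).
have cE : c = w k.+1 / us k.+1 * z k.+1.
  by apply: (mulIf (us_neq0 k.+1)); rewrite -zw mulrAC divfK // mulrC.
split=> [j|]; last first.
  by rewrite tk1 starredS sk starred_prod_last mul1r cE mulrA.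
rewrite leq_eqVlt => /orP[/eqP ->|jk].
  by rewrite starred_prod_last starredS sk /= mul1r divfK.
by rewrite wE // /null_vec (starred_prodSr b jk) starredS sk /= cE !mulrA.
Qed.

Local Notation Z n := (diag_mx (row_of_nat n z)).

Lemma mul_row_diag n w v :
  row_of_nat n w *m diag_mx (row_of_nat n v) = row_of_nat n (fun j => v j * w j).
Proof. by rewrite mul_mx_diag; apply/rowP=> j; rewrite !mxE mulrC. Qed.

Lemma mul_row_cmv b n w : w n = 0 ->
  row_of_nat n w *m (E b n *m E (~~ b) n)
  = row_of_nat n (act (~~ b) (trunc n (act b w))).
Proof.
move=> wn; rewrite mulmxA mul_row_blockmx // -row_of_nat_trunc.
by rewrite mul_row_blockmx // trunc_ge.
Qed.

Lemma row_of_natP n w v :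
  row_of_nat n w = row_of_nat n v <-> forall j, (j < n)%N -> w j = v j.
Proof.
split=> [/rowP wv j jn|wv]; first by have := wv (Ordinal jn); rewrite !mxE.
by apply/rowP=> j; rewrite !mxE wv.
Qed.

Lemma null_vectorP b n (W : 'rV[K]_n) : (forall j, us j != 0) -> u n = 0 ->
  W *m (E b n *m E (~~ b) n) = W *m Z n
  <-> exists c, W = c *: row_of_nat n (null_vec b n).
Proof.
move=> us_neq0 un; split=> [|[c ->]].
  rewrite -{1 2}(nat_of_rowK W) mul_row_cmv ?nat_of_row_ge // mul_row_diag.
  move/row_of_natP=> nullW; case: n un W nullW => [|n] un W nullW.
    by exists 0; apply/rowP=> -[].
  have [c [WE _]] := null_vector_prefix us_neq0 nullW (ltnSn n).
  exists c; rewrite -(nat_of_rowK W); apply/rowP=> j; rewrite !mxE WE //.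
  by rewrite -ltnS.
rewrite -!scalemxAl; congr (_ *: _).
rewrite mulmxA mul_row_diag -row_of_nat_trunc mul_row_blockmx ?trunc_ge //.
have -> : row_of_nat n (act b (trunc n (null_vec b n)))
    = row_of_nat n (trunc n (half_null_vec b n)).
  rewrite row_of_nat_trunc; apply/row_of_natP=> j jn.
  by rewrite act_null_vec // un mulr0 if_same subr0.
rewrite mul_row_blockmx ?trunc_ge //; apply/row_of_natP=> j jn.
by rewrite act_half_null_vec // un mulr0 if_same subr0.
Qed.

Local Notation E' := (blockmx ab a r).

Lemma blockmx_mul_conj b n : ~~ starred b n.-1 -> E b n *m E' b n = 1%:M.
Proof.
move=> sn; apply: row_act_inj => W; rewrite mulmx1.
rewrite mulmxA -{1}(nat_of_rowK W) mul_row_blockmx ?nat_of_row_ge //.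
rewrite -row_of_nat_trunc mul_row_blockmx ?trunc_ge // -[RHS]nat_of_rowK.
set w := nat_of_row W; apply/row_of_natP=> j jn.
have [sj|sj] := boolP (starred b j).
  rewrite [LHS]/block_act sj /trunc jn; case: ltnP => [jn1|nj1]; last first.
    have nE : n = j.+1 by apply/eqP; rewrite eqn_leq nj1 jn.
    by move: sn; rewrite nE sj.
  rewrite act_starred // act_starredS //.
  transitivity ((r j.+1 ^+ 2 + a j.+1 * ab j.+1) * w j); first by ring.
  by rewrite unitary mul1r.
rewrite [LHS]/block_act (negbTE sj) /trunc jn; case: j jn sj => [|j] jn sj.
  by rewrite a0 r0 act_unstarred0 //; ring.
rewrite /= ltnW // act_starredS ?act_starred; try by rewrite starredS in sj; apply: negbNE.
transitivity ((r j.+1 ^+ 2 + a j.+1 * ab j.+1) * w j.+1); first by ring.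
by rewrite unitary mul1r.
Qed.

(* For b = odd n the last index n - 1 is not starred, so that E b is not truncated
   and only E (~~ b) is; this choice is available since the order of the two
   factors is exchanged by transposition. *)
Definition cmv_const m : K :=
  \det (E (odd m.+1) m.+1) * (r m.+1 * (-1) ^+ m
    * \prod_(j < m) (if starred (odd m.+1) j then r j.+1 else - r j.+1)).

Lemma unstarred_last m : ~~ starred (odd m.+1) m.
Proof. by rewrite /starred /=; case: odd. Qed.

Lemma cmv_const_neq0 m : cmv_const m != 0.
Proof.
have EE := @blockmx_mul_conj _ m.+1 (unstarred_last m).
have : \det (E (odd m.+1) m.+1) != 0.
  by apply/eqP=> d0; move/eqP: (congr1 determinant EE);
    rewrite det_mulmx d0 mul0r det1 eq_sym oner_eq0.
move=> dE; rewrite /cmv_const !mulf_neq0 ?signr_eq0 //.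
by apply/prodf_neq0=> j _; case: ifP; rewrite ?oppr_eq0.
Qed.

Lemma det_cmv m (b := odd m.+1) : (forall k, z k != 0) ->
  \det (Z m.+1 - E b m.+1 *m E (~~ b) m.+1) = cmv_const m * u m.+1.
Proof.
move=> z_neq0; have sm := unstarred_last m; rewrite -/b in sm.
have EE := @blockmx_mul_conj b m.+1 sm.
pose N := E' b m.+1 *m Z m.+1 - E (~~ b) m.+1.
have NE : Z m.+1 - E b m.+1 *m E (~~ b) m.+1 = E b m.+1 *m N.
  by rewrite mulmxBr mulmxA EE mul1mx.
rewrite NE det_mulmx /cmv_const -[RHS]mulrA; congr (_ * _).
pose t := row_of_nat m.+1 (half_null_vec b m.+1).
have wE : row_of_nat m.+1 (null_vec b m.+1) *m E b m.+1 = t.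
  rewrite -row_of_nat_trunc mul_row_blockmx ?trunc_ge //.
  apply/row_of_natP=> j jm; rewrite act_null_vec // ifF ?subr0 //.
  by apply/negP=> /andP[/eqP[->]]; apply/negP.
have tN : t *m N = (r m.+1 * u m.+1) *: delta_mx 0 ord_max.
  rewrite mulmxBr mulmxA -{1}wE -(mulmxA _ (E b _)) EE mulmx1 mul_row_diag.
  rewrite -[t]row_of_nat_trunc mul_row_blockmx ?trunc_ge //.
  apply/rowP=> j; rewrite !mxE act_half_null_vec // opprB addrC subrK eqxx /=.
  rewrite -val_eqE /= eqSS; case: eqP => [->|_]; last by rewrite mulr0.
  by rewrite sm mulr1.
have Nij i j : N i j = E' b m.+1 i j * z j - E (~~ b) m.+1 i j.
  by rewrite /N mul_mx_diag !mxE.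
have Nlow (i j : 'I_m.+1) : (j.+1 < i)%N -> N i j = 0.
  by move=> ji; rewrite Nij !blockmx_low // mul0r subr0.
have := det_hessenberg Nlow tN.
have -> : \prod_(j < m) N (lift ord0 j) (lift ord_max j)
    = \prod_(j < m) (if starred b j then r j.+1 else - r j.+1)
      * \prod_(j < m | starred b j) z j.
  rewrite [X in _ * X]big_mkcond -big_split; apply: eq_bigr => j _ /=.
  have jE : lift ord_max j = j :> nat by rewrite /= /bump leqNgt ltn_ord.
  rewrite Nij !blockmx_subdiag ?jE // starredN.
  by case: ifP => _; rewrite ?mul0r ?sub0r ?subr0 ?mulr1.
have -> : t 0 0 = \prod_(j < m | starred b j) z j.
  rewrite mxE /half_null_vec /starred_prod u0 us0 mulr1 mulrC.
  transitivity (\prod_(0 <= l < m.+1 | starred b l) z l).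
    by rewrite [in RHS]big_ltn_cond //; case: ifP; rewrite ?mul1r.
  by rewrite big_mkcond big_nat_recr //= (negbTE sm) mulr1 -big_mkcond big_mkord.
move=> H; apply: (@mulfI _ (\prod_(j < m | starred b j) z j)).
  by apply/prodf_neq0.
by rewrite H; ring.
Qed.

End Transfer.

(** * Location of zeros *)

Section TransferGrowth.
Variable C : numClosedFieldType.

(* |x + a y|^2 - |a^* x + y|^2 = (1 - |a|^2) (|x|^2 - |y|^2) *)
Lemma ler_norm_transfer (a x y : C) : `|a| <= 1 -> `|y| <= `|x| ->
  `|a^* * x + y| <= `|x + a * y|.
Proof.
move=> a1 yx; rewrite -ler_sqr ?nnegrE // -subr_ge0 !normCK !rmorphD !rmorphM /= conjCK.
rewrite (_ : _ - _ = (1 - a * a^*) * (x * x^* - y * y^*)); last by ring.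
by rewrite -!normCK mulr_ge0 // subr_ge0 ?expr_le1 // ler_sqr ?nnegrE.
Qed.

Lemma transfer_dominates (P Q s t e a : nat -> C) :
    `|Q 0| <= `|P 0| -> P 0 != 0 ->
    (forall k, P k.+1 = e k.+1 * (s k * P k + a k.+1 * (t k * Q k))) ->
    (forall k, Q k.+1 = e k.+1 * ((a k.+1)^* * (s k * P k) + t k * Q k)) ->
    (forall k, e k.+1 != 0) -> (forall k, `|a k.+1| < 1) ->
    (forall k, `|t k| <= `|s k|) -> (forall k, s k != 0) ->
  forall k, `|Q k| <= `|P k| /\ P k != 0.
Proof.
move=> QP0 P0 PS QS e0 a1 ts s0; elim=> [//|k [QP Pk]].
have yx : `|t k * Q k| <= `|s k * P k| by rewrite !normrM ler_pM.
split.
  by rewrite PS QS !normrM ler_wpM2l // ler_norm_transfer // ltW.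
rewrite PS mulf_neq0 // addr_eq0; apply: contraTneq (a1 k) => /(congr1 Num.norm).
rewrite normrN [in RHS]normrM => xE; rewrite -real_leNgt ?realE ?normr_ge0 ?ler01 //.
have x0 : 0 < `|s k * P k| by rewrite normr_gt0 mulf_neq0.
by rewrite -(ler_pM2r x0) mul1r [X in X <= _]xE ler_wpM2l.
Qed.

End TransferGrowth.

Section OrfPolys.
Variable R : realType.
Local Notation C := R[i].
Variables (alpha a : nat -> C).
Hypothesis alpha_lt1 : forall n, `|alpha n| < 1.
Hypothesis a_lt1 : forall n, `|a n.+1| < 1.

Fixpoint orf_polys n : {poly C} * {poly C} :=
  if n is k.+1 then
    let: (p, q) := orf_polys k in
    (e_ alpha a k.+1 *: (varpistar alpha k * p + a k.+1 *: (varpi alpha k * q)),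
     e_ alpha a k.+1 *:
       ((a k.+1)^* *: (varpistar alpha k * p) + varpi alpha k * q))
  else (1, 1).

Definition orf_num n := (orf_polys n).1.
Definition orf_num_star n := (orf_polys n).2.

Local Notation p := orf_num.
Local Notation q := orf_num_star.

Lemma orf_numS k : p k.+1
  = e_ alpha a k.+1 *: (varpistar alpha k * p k + a k.+1 *: (varpi alpha k * q k)).
Proof. by rewrite /orf_num /orf_num_star /=; case: orf_polys. Qed.

Lemma orf_num_starS k : q k.+1
  = e_ alpha a k.+1 *:
     ((a k.+1)^* *: (varpistar alpha k * p k) + varpi alpha k * q k).
Proof. by rewrite /orf_num /orf_num_star /=; case: orf_polys. Qed.

Definition defect k : C := sqrtC (1 - `|alpha k| ^+ 2).

Lemma one_sub_sqr_gt0 (x : C) : `|x| < 1 -> 0 < 1 - `|x| ^+ 2.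
Proof. by move=> x1; rewrite subr_gt0 exprn_ilt1. Qed.

Lemma defect_gt0 k : 0 < defect k.
Proof. by rewrite sqrtC_gt0 one_sub_sqr_gt0. Qed.

Lemma rho_gt0 k : 0 < rho a k.+1.
Proof. by rewrite sqrtC_gt0 one_sub_sqr_gt0. Qed.

Lemma e_defect k : e_ alpha a k.+1 = defect k.+1 / (defect k * rho a k.+1).
Proof.
have vE n : (varpi alpha n).[alpha n] = 1 - `|alpha n| ^+ 2.
  by rewrite /varpi !hornerE normCKC.
rewrite /e_ !vE /=.
have g1 := ltW (one_sub_sqr_gt0 (alpha_lt1 k.+1)).
have g0 := ltW (one_sub_sqr_gt0 (alpha_lt1 k)).
have ga := ltW (one_sub_sqr_gt0 (a_lt1 k)).
rewrite sqrtCM ?nnegrE ?divr_ge0 // sqrtCM ?nnegrE ?invr_ge0 //.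
by rewrite div1r !rootCV // invfM mulrA.
Qed.

Lemma e_neq0 k : e_ alpha a k.+1 != 0.
Proof.
by rewrite e_defect mulf_neq0 ?invr_neq0 ?mulf_neq0 ?gt_eqF ?defect_gt0 ?rho_gt0.
Qed.

Lemma horner_varpi k x : (varpi alpha k).[x] = 1 - (alpha k)^* * x.
Proof. by rewrite /varpi !hornerE. Qed.

Lemma horner_varpistar k x : (varpistar alpha k).[x] = x - alpha k.
Proof. by rewrite /varpistar !hornerE. Qed.

Lemma varpistar_sub_varpi k x : `|(varpistar alpha k).[x]| ^+ 2
    - `|(varpi alpha k).[x]| ^+ 2 = (`|x| ^+ 2 - 1) * (1 - `|alpha k| ^+ 2).
Proof.
rewrite horner_varpi horner_varpistar !normCK !(rmorphB, rmorphM) rmorph1 /= conjCK.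
by ring.
Qed.

Lemma horner_orf_num_starS k x : (q k.+1).[x]
  = e_ alpha a k.+1 * ((a k.+1)^* * ((varpistar alpha k).[x] * (p k).[x])
                       + (varpi alpha k).[x] * (q k).[x]).
Proof. by rewrite orf_num_starS !hornerE. Qed.

Lemma horner_orf_numS k x : (p k.+1).[x]
  = e_ alpha a k.+1 * ((varpistar alpha k).[x] * (p k).[x]
                       + a k.+1 * ((varpi alpha k).[x] * (q k).[x])).
Proof. by rewrite orf_numS !hornerE. Qed.

Lemma orf_num_neq0_out x k : 1 <= `|x| -> (p k).[x] != 0.
Proof.
move=> x1; have [] // := @transfer_dominates _
  (fun k => (p k).[x]) (fun k => (q k).[x]) (fun k => (varpistar alpha k).[x])
  (fun k => (varpi alpha k).[x]) (e_ alpha a) a _ _ _ _ _ _ _ _ k => //=.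
- by rewrite hornerC oner_eq0.
- by move=> {}k; rewrite horner_orf_numS.
- by move=> {}k; rewrite horner_orf_num_starS.
- exact: e_neq0.
- move=> {}k; rewrite -ler_sqr ?nnegrE // -subr_ge0 varpistar_sub_varpi.
  by rewrite mulr_ge0 ?(ltW (one_sub_sqr_gt0 _)) // subr_ge0 expr_ge1.
move=> {}k; rewrite horner_varpistar subr_eq0; apply: contraTneq x1 => ->.
by rewrite -real_ltNge // ?realE ?normr_ge0 ?ler01.
Qed.

Lemma varpi_neq0_in x k : `|x| < 1 -> (varpi alpha k).[x] != 0.
Proof.
move=> x1; rewrite horner_varpi subr_eq0 eq_sym; apply/eqP=> /(congr1 Num.norm).
rewrite normrM norm_conjC normr1 => ax1.
have := mulr_ilt1 (normr_ge0 _) (normr_ge0 _) (alpha_lt1 k) x1.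
by rewrite ax1 ltxx.
Qed.

Lemma orf_num_star_neq0_in x k : `|x| < 1 -> (q k).[x] != 0.
Proof.
move=> x1; have [] // := @transfer_dominates _
  (fun k => (q k).[x]) (fun k => (p k).[x]) (fun k => (varpi alpha k).[x])
  (fun k => (varpistar alpha k).[x]) (e_ alpha a) (fun k => (a k)^*)
  _ _ _ _ _ _ _ _ k => //=.
- by rewrite hornerC oner_eq0.
- by move=> {}k; rewrite horner_orf_num_starS addrC.
- by move=> {}k; rewrite horner_orf_numS conjCK addrC.
- exact: e_neq0.
- by move=> {}k; rewrite norm_conjC.
- move=> {}k; rewrite -ler_sqr ?nnegrE // -subr_le0 varpistar_sub_varpi.
  rewrite mulr_le0_ge0 ?(ltW (one_sub_sqr_gt0 _)) // subr_le0.
  by rewrite expr_le1 // ltW.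
by move=> {}k; apply: varpi_neq0_in.
Qed.

Lemma size_varpi k : (size (varpi alpha k) <= 2)%N.
Proof.
rewrite (leq_trans (size_polyD _ _)) // geq_max size_poly1 size_polyN.
by rewrite (leq_trans (size_scale_leq _ _)) // size_polyX.
Qed.

Lemma size_varpistar k : size (varpistar alpha k) = 2%N.
Proof. by rewrite size_XsubC. Qed.

Lemma size_orf_num k : (size (p k) <= k.+1)%N /\ (size (q k) <= k.+1)%N.
Proof.
elim: k => [|k [sp sq]]; first by rewrite /= size_poly1.
have s1 : (size (varpistar alpha k * p k)%R <= k.+2)%N.
  by rewrite (leq_trans (size_polyMleq _ _)) // size_varpistar.
have s2 : (size (varpi alpha k * q k)%R <= k.+2)%N.
  rewrite (leq_trans (size_polyMleq _ _)) //.
  by have := size_varpi k; move: sq; lia.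
by rewrite orf_numS orf_num_starS; split; rewrite (leq_trans (size_scale_leq _ _)) //
  (leq_trans (size_polyD _ _)) // geq_max ?s1 ?s2 ?andbT ?(leq_trans (size_scale_leq _ _)).
Qed.

End OrfPolys.

Lemma coefM_top (K : comNzRingType) (f g : {poly K}) m n :
  (size f <= m.+1)%N -> (size g <= n.+1)%N -> (f * g)`_(m + n) = f`_m * g`_n.
Proof.
move=> sf sg; rewrite coefM (bigD1 (inord m)) //= inordK ?ltnS ?leq_addr //.
rewrite addKn big1 ?addr0 // => i; rewrite -val_eqE /= inordK ?ltnS ?leq_addr //.
move=> im; have [lt|ge] := ltnP i m.
  by rewrite [g`__]nth_default ?mulr0 // (leq_trans sg) //; lia.
by rewrite nth_default ?mul0r // (leq_trans sf) //; lia.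
Qed.

Lemma size_prod_le2 (K : comNzRingType) (I : Type) (s : seq I) (F : I -> {poly K}) :
  (forall i, size (F i) <= 2)%N ->
  (size (\prod_(i <- s) F i)%R <= (size s).+1)%N
  /\ (\prod_(i <- s) F i)`_(size s) = \prod_(i <- s) (F i)`_1.
Proof.
move=> F2; elim: s => [|i s [IHs IHc]]; first by rewrite !big_nil size_poly1 coef1.
rewrite !big_cons /= -[(size s).+1]add1n coefM_top // IHc; split=> //.
rewrite (leq_trans (size_polyMleq _ _)) //.
by rewrite -subn1 leq_subLR (leq_trans (leq_add (F2 i) IHs)).
Qed.

Lemma coef_det_pencil (K : comNzRingType) n (S T : 'M[K]_n) :
  (\det ('X *: map_mx polyC S - map_mx polyC T))`_n = \det S.
Proof.
rewrite /determinant coef_sum; apply: eq_bigr => s _.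
have cE (i j : 'I_n) : ('X *: map_mx polyC S - map_mx polyC T) i j
    = S i j *: 'X - (T i j)%:P by rewrite !mxE mulrC mul_polyC.
under eq_bigr => i _ do rewrite cE.
have le2 i : (size (S i (s i) *: 'X - (T i (s i))%:P)%R <= 2)%N.
  rewrite (leq_trans (size_polyD _ _)) // geq_max size_polyN.
  rewrite (leq_trans (size_scale_leq _ _)) ?size_polyX //=.
  by rewrite (leq_trans (size_polyC_leq1 _)).
have [_] := size_prod_le2 (index_enum 'I_n) le2.
rewrite -[index_enum _]enumT size_enum_ord enumT => coefE.
rewrite -polyC1 -polyCN -rmorphXn /= coefCM coefE.
congr (_ * _); apply: eq_bigr => i _.
by rewrite coefB coefZ coefX coefC mulr1 subr0.
Qed.

Section OrfPolysTop.
Variable R : realType.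
Local Notation C := R[i].
Variables (alpha a : nat -> C).
Hypothesis alpha_lt1 : forall n, `|alpha n| < 1.
Hypothesis a_lt1 : forall n, `|a n.+1| < 1.

Local Notation p := (orf_num alpha a).
Local Notation q := (orf_num_star alpha a).

Lemma orf_num_coef_neq0 k : (p k)`_k != 0.
Proof.
have vs k' (f : {poly C}) : (size f <= k'.+1)%N ->
  (varpistar alpha k' * f)`_k'.+1 = 1 * f`_k'.
  move=> sf; rewrite -[k'.+1]add1n coefM_top ?size_varpistar //.
  by rewrite coefB coefX coefC subr0.
have v k' (f : {poly C}) : (size f <= k'.+1)%N ->
  (varpi alpha k' * f)`_k'.+1 = - (alpha k')^* * f`_k'.
  move=> sf; rewrite -[k'.+1]add1n coefM_top ?size_varpi //.
  by rewrite coefB coefZ coefX coef1 mulr1 sub0r.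
have [] // := @transfer_dominates _
  (fun k => (p k)`_k) (fun k => (q k)`_k) (fun => 1)
  (fun k => - (alpha k)^*) (e_ alpha a) a _ _ _ _ _ _ _ _ k => //=.
- by rewrite coefC oner_eq0.
- move=> {}k; have [sp sq] := size_orf_num alpha a k.
  by rewrite orf_numS coefZ coefD coefZ vs // v.
- move=> {}k; have [sp sq] := size_orf_num alpha a k.
  by rewrite orf_num_starS coefZ coefD coefZ vs // v.
- by move=> {}k; apply: e_neq0.
by move=> {}k; rewrite normrN norm_conjC normr1 ltW.
Qed.

End OrfPolysTop.

(** * Normalized orthogonal rational functions *)

Section Images.
Variable R : realType.
Local Notation C := R[i].
Variables (alpha a : nat -> C).
Hypothesis alpha0 : alpha 0%N = 0.
Hypothesis alpha_lt1 : forall n, `|alpha n| < 1.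
Hypothesis a_lt1 : forall n, `|a n.+1| < 1.

(* Only the a_n with n >= 1 are constrained; a_0 = 1, rho_0 = 0 makes the leading
   1 x 1 block of C_e a truncated Theta_0. *)
Definition ext_a k : C := if k is 0 then 1 else a k.
Definition ext_ac k : C := (ext_a k)^*.
Definition ext_rho k : C := if k is 0 then 0 else rho a k.

Variables (K : fieldType) (f : {rmorphism {poly C} -> K}).
Hypothesis f_varpi : forall k, f (varpi alpha k) != 0.

Definition zeta_of k : K := f (varpistar alpha k) / f (varpi alpha k).
Definition normal_orf (num : nat -> {poly C}) k : K :=
  f (num k) / f (pi_ alpha k) * (f (varpi alpha k) / f (defect alpha k)%:P).

Local Notation c := (f \o polyC).

Lemma rmorph_polyC_neq0 (x : C) : x != 0 -> f x%:P != 0.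
Proof. by rewrite -[f _]/((f \o polyC) x) fmorph_eq0. Qed.

Lemma rmorph_defect_neq0 k : f (defect alpha k)%:P != 0.
Proof. by rewrite rmorph_polyC_neq0 // gt_eqF // defect_gt0. Qed.

Lemma rmorph_rho_neq0 k : f (rho a k.+1)%:P != 0.
Proof. by rewrite rmorph_polyC_neq0 // gt_eqF // rho_gt0. Qed.

Lemma rmorph_pi_neq0 k : f (pi_ alpha k) != 0.
Proof.
by rewrite /pi_ rmorph_prod prodf_seq_neq0; apply/allP => i _ /=.
Qed.

Lemma pi_recr k : pi_ alpha k.+1 = pi_ alpha k * varpi alpha k.+1.
Proof. by rewrite /pi_ big_nat_recr. Qed.

Lemma ext_unitary k : c (ext_rho k) ^+ 2 + c (ext_a k) * c (ext_ac k) = 1.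
Proof.
rewrite /= -!rmorphXn -!rmorphM -!rmorphD /= /ext_ac.
case: k => [|k] /=; first by rewrite expr0n /= add0r conjC1 mulr1 !rmorph1.
by rewrite /rho sqrtCK -normCK subrK !rmorph1.
Qed.

Lemma normal_orf0 num : num 0%N = 1 -> normal_orf num 0 = 1.
Proof.
move=> n0; rewrite /normal_orf n0 /pi_ big_geq // /defect /varpi alpha0 normr0 expr0n /=.
by rewrite conjC0 scale0r !subr0 sqrtC1 !rmorph1 !divr1 mulr1.
Qed.

Let normal_orf_step k : let x := f (varpistar alpha k) * f (orf_num alpha a k) in
  let y := f (varpi alpha k) * f (orf_num_star alpha a k) in
  let d := f (pi_ alpha k) * f (defect alpha k)%:P * f (rho a k.+1)%:P in
  normal_orf (orf_num alpha a) k.+1 = (x + f (a k.+1)%:P * y) / d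
  /\ normal_orf (orf_num_star alpha a) k.+1 = (f (a k.+1)^*%:P * x + y) / d.
Proof.
move=> x y d; rewrite /normal_orf pi_recr orf_numS orf_num_starS -!mul_polyC !rmorphM.
rewrite (rmorphD f (varpistar alpha k * _)) (rmorphD f (_ * (varpistar alpha k * _))).
rewrite !rmorphM e_defect // -/x -/y.
have -> : f (defect alpha k.+1 / (defect alpha k * rho a k.+1))%:P
    = f (defect alpha k.+1)%:P / (f (defect alpha k)%:P * f (rho a k.+1)%:P).
  by rewrite -[LHS]/((f \o polyC) _) fmorph_div rmorphM.
move: (rmorph_defect_neq0 k) (rmorph_rho_neq0 k) (rmorph_pi_neq0 k) (f_varpi k.+1) (rmorph_defect_neq0 k.+1).
rewrite {}/d; clearbody x y.
move: (f (defect alpha k)%:P) (f (rho a k.+1)%:P) (f (pi_ alpha k))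
  (f (varpi alpha k.+1)) (f (defect alpha k.+1)%:P)
  (f (a k.+1)%:P) (f (a k.+1)^*%:P) => d r g v d' b bc d0 r0 g0 v0 d'0.
by split; field; rewrite ?d0 ?r0 ?g0 ?v0 ?d'0.
Qed.

Lemma zeta_normal_orf k : zeta_of k * normal_orf (orf_num alpha a) k
  = - c (ext_a k.+1) * normal_orf (orf_num_star alpha a) k
    + c (ext_rho k.+1) * normal_orf (orf_num alpha a) k.+1.
Proof.
have [-> _] := normal_orf_step k; rewrite /zeta_of /normal_orf /=.
move: (rmorph_defect_neq0 k) (rmorph_rho_neq0 k) (rmorph_pi_neq0 k) (f_varpi k).
move: (f (defect alpha k)%:P) (f (rho a k.+1)%:P) (f (pi_ alpha k))
  (f (varpi alpha k)) (f (varpistar alpha k)) (f (a k.+1)%:P)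
  (f (orf_num alpha a k)) (f (orf_num_star alpha a k))
  => d r g v vs b x y d0 r0 g0 v0.
by field; rewrite ?d0 ?r0 ?g0 ?v0.
Qed.

Lemma normal_orf_starS k : normal_orf (orf_num_star alpha a) k.+1
  = c (ext_rho k.+1) * normal_orf (orf_num_star alpha a) k
    + c (ext_ac k.+1) * normal_orf (orf_num alpha a) k.+1.
Proof.
have := ext_unitary k.+1; have [-> ->] := normal_orf_step k; rewrite /normal_orf /= /ext_ac /=.
move: (rmorph_defect_neq0 k) (rmorph_rho_neq0 k) (rmorph_pi_neq0 k).
move: (f (defect alpha k)%:P) (f (rho a k.+1)%:P) (f (pi_ alpha k))
  (f (varpi alpha k)) (f (varpistar alpha k)) (f (a k.+1)%:P)
  (f (a k.+1)^*%:P) (f (orf_num alpha a k)) (f (orf_num_star alpha a k))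
  => d r g v vs b bc x y d0 r0 g0 rE.
apply: (@mulIf _ (g * d * r)); first by rewrite !mulf_neq0.
rewrite divfK ?mulf_neq0 //.
transitivity (r ^+ 2 * (v * y) + bc * (vs * x + b * (v * y))); last first.
  by field; rewrite d0 r0 g0.
transitivity ((r ^+ 2 + b * bc) * (v * y) + bc * (vs * x)); last by ring.
by rewrite rE; ring.
Qed.

End Images.

(** * The matrix U *)

Section Cmv.
Variable R : realType.
Local Notation C := R[i].
Implicit Types (alpha a : nat -> C).

Ltac decide_nat_eqs :=
  repeat match goal with |- context [@eq_op _ ?x ?y] =>
    first [have -> : (x == y :> nat) = true by lia
          |have -> : (x == y :> nat) = false by lia] end.

Lemma block_sum_entry a (A Ac r : nat -> C) i j :
  (forall k, A k.+1 = a k.+1) -> (forall k, Ac k.+1 = (a k.+1)^*) ->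
  (forall k, r k.+1 = rho a k.+1) ->
  block_sum (fun k => Theta a k.*2.+1) i j = block_entry A Ac r false i j.
Proof.
move=> AE AcE rE; rewrite /block_sum /block_entry /starred.
have [e [k ->]] : exists (e : bool) k, i = (e + k.*2)%N.
  by exists (odd i), i./2; rewrite odd_double_half.
have [e' [l ->]] : exists (e : bool) k, j = (e + k.*2)%N.
  by exists (odd j), j./2; rewrite odd_double_half.
rewrite !half_bit_double !oddD !odd_double !addbF !oddb mxE !inordK //; try lia.
have [->|kl] := eqVneq k l; case: e; case: e' => /=; decide_nat_eqs;
  by rewrite ?add0n ?add1n ?AE ?AcE ?rE ?(mulr0n, mulr1n, mul0r, mulr0, mul1r, addr0, add0r).
Qed.

Lemma Co_entry a i j :
  Co a i j = block_entry (ext_a a) (ext_ac a) (ext_rho a) false i j.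
Proof. exact: block_sum_entry. Qed.

Lemma Ce_entry a i j :
  Ce a i j = block_entry (ext_a a) (ext_ac a) (ext_rho a) true i j.
Proof.
case: i j => [|i] [|j].
- by rewrite /block_entry /= /ext_ac conjC1 mulr0n !mul0r mulr1 !addr0.
- rewrite /Ce /block_entry /starred /=.
  by case: j => [|j] /=; rewrite ?mul0r ?mulr0 ?addr0.
- rewrite /Ce /block_entry /starred /=.
  by rewrite !mulr0 !mul0r !addr0.
rewrite [LHS](@block_sum_entry (a \o S) (ext_a a \o S) (ext_ac a \o S)
  (ext_rho a \o S)) // /block_entry !eqSS /starred /=.
by case: (odd j).
Qed.

Lemma principal_Cmx a n : principal (Cmx a) n
  = blockmx (ext_a a) (ext_ac a) (ext_rho a) false n
    *m blockmx (ext_a a) (ext_ac a) (ext_rho a) true n.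
Proof.
apply/matrixP=> i j; rewrite !mxE /Cmx.
under eq_bigr => k _ do rewrite Co_entry Ce_entry.
under [RHS]eq_bigr => k _ do rewrite !mxE.
pose E := block_entry (ext_a a) (ext_ac a) (ext_rho a).
pose F (k : nat) := E false i k * E true k j.
rewrite -[LHS](big_mkord xpredT F) -[RHS](big_mkord xpredT F).
have F0 k : (i.+1 < k)%N -> F k = 0.
  move=> ik; rewrite /F /E {1}/block_entry; decide_nat_eqs.
  by rewrite ?mulr0n !mul0r !addr0 mul0r.
have Fn (k l m : nat) : (k < m)%N -> (l < m)%N -> E false k m * E true m l = 0.
  move=> km lm; rewrite /E /block_entry; decide_nat_eqs.
  rewrite ?mulr0n !mul0r !add0r !addr0 /starred.
  have [ml|] := eqVneq m l.+1; last by rewrite mul0r mulr0.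
  by rewrite ml /=; case: (odd l); rewrite /= ?mulr0 ?mul0r.
transitivity (\sum_(0 <= k < n.+1) F k); last by rewrite big_nat_recr //= /F Fn ?addr0.
rewrite [RHS](@big_cat_nat _ _ _ i.+2) //= ?ltnS ?ltn_ord //.
rewrite [X in _ + X]big_nat_cond [X in _ + X]big1 ?addr0 // => k.
by rewrite andbT => /andP[ik _]; apply: F0.
Qed.

End Cmv.

Section Mobius.
Variable R : realType.
Local Notation C := R[i].

Lemma mxsqrt_diag n (d : 'rV[C]_n) :
  mxsqrt (diag_mx d) = diag_mx (map_mx sqrtC d).
Proof.
have trd : (diag_mx d)^t* = diag_mx (map_mx Num.conj d).
  by rewrite tr_diag_mx map_diag_mx.
have /orthomx_spectralP : diag_mx d \is normalmx.
  by apply/normalmxP; rewrite trd diag_mxC.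
have Pu := spectral_unit (diag_mx d).
rewrite /mxsqrt; set P := spectralmx _ in Pu *; set D := spectral_diag _ => dE.
have PE : P *m diag_mx d = diag_mx D *m P by rewrite dE mulmxA mulmxA mulmxV // mul1mx.
suff -> : diag_mx (map_mx sqrtC D) = P *m diag_mx (map_mx sqrtC d) *m invmx P.
  by rewrite -!mulmxA mulVmx // mulmx1 mulmxA mulVmx // mul1mx.
suff <- : diag_mx (map_mx sqrtC D) *m P = P *m diag_mx (map_mx sqrtC d).
  by rewrite -mulmxA mulmxV // mulmx1.
apply/matrixP=> i j; have := congr1 (fun M : 'M[C]_n => M i j) PE.
rewrite !mul_mx_diag !mul_diag_mx !mxE => /eqP.
rewrite [D 0 i * _]mulrC -subr_eq0 -mulrBr mulf_eq0 subr_eq0.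
by case/orP=> /eqP ->; rewrite ?mulr0 ?mul0r // mulrC.
Qed.

Variables (alpha a : nat -> C).
Hypothesis alpha_lt1 : forall n, `|alpha n| < 1.

Local Notation H n := (diag_mx (row_of_nat n (defect alpha))).
Local Notation A n := (diag_mx (row_of_nat n alpha)).
Local Notation Ac n := (diag_mx (row_of_nat n (fun k => (alpha k)^*))).
Local Notation F n := (principal (Cmx a) n).

Lemma principal_Amx n : principal (Amx alpha) n = A n.
Proof. by apply/matrixP=> i j; rewrite !mxE /Amx -val_eqE /=; case: eqP. Qed.

Lemma diag_conjT n (w : nat -> C) :
  (diag_mx (row_of_nat n w))^t* = diag_mx (row_of_nat n (fun k => (w k)^*)).
Proof.
rewrite tr_diag_mx map_diag_mx; congr diag_mx.
by apply/rowP=> j; rewrite !mxE.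
Qed.

Lemma eta_diag n (w : nat -> C) : eta (diag_mx (row_of_nat n w))
  = diag_mx (row_of_nat n (fun k => sqrtC (1 - `|w k| ^+ 2))).
Proof.
rewrite /eta diag_conjT.
have -> : 1%:M - diag_mx (row_of_nat n w)
      *m diag_mx (row_of_nat n (fun k => (w k)^*))
    = diag_mx (row_of_nat n (fun k => 1 - `|w k| ^+ 2)).
  apply/matrixP=> i j; rewrite mul_diag_mx !mxE.
  by case: eqP => [->|_]; rewrite ?mulr0n ?mulr1n ?mulr0 ?subr0 // normCK.
by rewrite mxsqrt_diag; congr diag_mx; apply/rowP=> j; rewrite !mxE.
Qed.

Lemma Umx_diag n : Umx alpha a n
  = invmx (H n) *m (F n + A n) *m invmx (1%:M + Ac n *m F n) *m H n.
Proof.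
rewrite /Umx /mobius principal_Amx diag_conjT !eta_diag.
congr (_ *m _); congr diag_mx; apply/rowP=> j; rewrite !mxE.
by rewrite norm_conjC.
Qed.

End Mobius.

Lemma rmorph_cmv_const (K L : fieldType) (f : {rmorphism K -> L}) (a ab r : nat -> K) m :
  cmv_const (f \o a) (f \o ab) (f \o r) m = f (cmv_const a ab r m).
Proof.
rewrite /cmv_const !rmorphM -det_map_mx map_blockmx rmorph_prod rmorph_sign.
congr (_ * (_ * _)); apply: eq_bigr => j _ /=.
by case: ifP; rewrite ?rmorphN.
Qed.

Lemma mul_diag_row_of_nat (K : fieldType) n (v w : nat -> K) :
  diag_mx (row_of_nat n v) *m diag_mx (row_of_nat n w)
  = diag_mx (row_of_nat n (fun k => v k * w k)).
Proof.
by apply/matrixP=> i j; rewrite mul_diag_mx !mxE mulrnAr.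
Qed.

Lemma diag_row_of_nat_unit (K : fieldType) n (v : nat -> K) :
  (forall k, v k != 0) -> diag_mx (row_of_nat n v) \in unitmx.
Proof.
by move=> v0; rewrite unitmxE det_diag unitfE; apply/prodf_neq0 => i _; rewrite mxE.
Qed.

Section CharPoly.
Variable R : realType.
Local Notation C := R[i].
Variables (alpha a : nat -> C).
Hypothesis alpha0 : alpha 0%N = 0.
Hypothesis alpha_lt1 : forall n, `|alpha n| < 1.
Hypothesis a_lt1 : forall n, `|a n.+1| < 1.

Local Notation H n := (diag_mx (row_of_nat n (defect alpha))).
Local Notation A n := (diag_mx (row_of_nat n alpha)).
Local Notation Ac n := (diag_mx (row_of_nat n (fun k => (alpha k)^*))).
Local Notation F n := (principal (Cmx a) n).
Local Notation S n := (1%:M + Ac n *m F n).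
Local Notation pencil n :=
  ('X *: map_mx polyC (S n) - map_mx polyC (F n + A n)).

Lemma prod_varpi n : \prod_(k < n.+1) varpi alpha k = pi_ alpha n.
Proof.
rewrite /pi_ -(big_mkord xpredT (varpi alpha)) big_ltn //.
by rewrite /varpi alpha0 conjC0 scale0r subr0 mul1r.
Qed.

Lemma varpi_neq0 k : varpi alpha k != 0.
Proof.
apply/eqP=> /(congr1 (fun f => f.[0])).
by rewrite horner_varpi mulr0 subr0 horner0 => /eqP; rewrite oner_eq0.
Qed.

Section FractionField.
Variables (K : fieldType) (f : {rmorphism {poly C} -> K}).
Hypothesis f_inj : injective f.
Local Notation c := (f \o polyC).

Let inj_rmorph_neq0 x : x != 0 -> f x != 0.
Proof. by apply: contra_neq => fx; apply: f_inj; rewrite fx rmorph0. Qed.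

Let f_varpi k : f (varpi alpha k) != 0.
Proof. exact/inj_rmorph_neq0/varpi_neq0. Qed.

Lemma map_pencil n : map_mx f (pencil n)
  = diag_mx (row_of_nat n (fun k => f (varpi alpha k)))
    *m (diag_mx (row_of_nat n (zeta_of alpha f))
        - blockmx (c \o ext_a a) (c \o ext_ac a) (c \o ext_rho a) false n
          *m blockmx (c \o ext_a a) (c \o ext_ac a) (c \o ext_rho a) true n).
Proof.
rewrite -!map_blockmx -map_mxM -principal_Cmx mulmxBr mul_diag_row_of_nat.
rewrite !mul_diag_mx; apply/matrixP=> i j; rewrite !mxE /zeta_of mulrCA divff //.
rewrite mulr1 [_ (Cmx a i j)]/= -(rmorphMn f) -(rmorphM f) -(rmorphB f); congr (f _).
rewrite /varpi /varpistar -!mul_polyC !(polyCD, polyCM) polyCMn.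
by case: eqP => _; rewrite ?mulr1n ?mulr0n ?polyC1 ?polyC0; ring.
Qed.

Lemma det_pencil_field m :
  \det (pencil m.+1) = (cmv_const (ext_a a) (ext_ac a) (ext_rho a) m
                        / defect alpha m.+1) *: orf_num alpha a m.+1.
Proof.
have detE : \det (diag_mx (row_of_nat m.+1 (zeta_of alpha f))
        - blockmx (c \o ext_a a) (c \o ext_ac a) (c \o ext_rho a) false m.+1
          *m blockmx (c \o ext_a a) (c \o ext_ac a) (c \o ext_rho a) true m.+1)
    = c (cmv_const (ext_a a) (ext_ac a) (ext_rho a) m)
      * normal_orf alpha f (orf_num alpha a) m.+1.
  have ac0 : (c \o ext_ac a) 0 = 1 by rewrite /= /ext_ac conjC1 !rmorph1.
  have ea0 : (c \o ext_a a) 0 = 1 by rewrite /= !rmorph1.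
  have rh0 : (c \o ext_rho a) 0 = 0 by rewrite /= !rmorph0.
  have zn k : zeta_of alpha f k != 0.
    rewrite /zeta_of mulf_neq0 ?invr_neq0 // inj_rmorph_neq0 //.
    by rewrite -size_poly_eq0 size_varpistar.
  rewrite -rmorph_cmv_const -(det_cmv ac0 ea0 rh0 (ext_unitary a f)
    (normal_orf0 alpha0 f (erefl : orf_num alpha a 0 = 1))
    (normal_orf0 alpha0 f (erefl : orf_num_star alpha a 0 = 1))
    (zeta_normal_orf alpha_lt1 a_lt1 f_varpi) (normal_orf_starS alpha_lt1 a_lt1 f_varpi) m zn).
  case: (odd m.+1) => //=.
  by rewrite -det_tr linearB /= tr_diag_mx trmx_mul !blockmx_tr.
apply: f_inj; rewrite -[LHS](det_map_mx f) map_pencil det_mulmx det_diag detE.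
under eq_bigr => k _ do rewrite mxE.
rewrite -rmorph_prod -mul_polyC (rmorphM f).
have -> : f (cmv_const (ext_a a) (ext_ac a) (ext_rho a) m / defect alpha m.+1)%:P
    = c (cmv_const (ext_a a) (ext_ac a) (ext_rho a) m) / f (defect alpha m.+1)%:P.
  by rewrite -[LHS]/(c _) fmorph_div.
have piE : f (\prod_(k < m.+1) varpi alpha k) * f (varpi alpha m.+1)
    = f (pi_ alpha m.+1) by rewrite prod_varpi pi_recr rmorphM.
have pi0 : f (pi_ alpha m.+1) != 0 by apply: rmorph_pi_neq0.
have d0 := @rmorph_defect_neq0 _ _ alpha_lt1 _ f m.+1.
rewrite /normal_orf -piE in pi0 *.
move: pi0 d0; move: (f (\prod_(k < _) _)) (f (varpi _ _)) (f (defect _ _)%:P)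
  (f (orf_num _ _ _)) (c _) => x y d g k xy0 d0.
have := xy0; rewrite mulf_eq0 => /norP[x0 y0].
by field; rewrite x0 y0 d0.
Qed.

End FractionField.

Lemma det_pencil m :
  \det (pencil m.+1) = (cmv_const (ext_a a) (ext_ac a) (ext_rho a) m
                        / defect alpha m.+1) *: orf_num alpha a m.+1.
Proof.
apply: (det_pencil_field (f := @FracField.tofrac {poly C})).
by move=> x y /eqP; rewrite tofrac_eq => /eqP.
Qed.

Lemma det_moebius_denom_neq0 m : \det (S m.+1) != 0.
Proof.
rewrite -(coef_det_pencil _ (F m.+1 + A m.+1)) det_pencil coefZ.
rewrite mulf_neq0 ?orf_num_coef_neq0 // mulf_neq0 ?invr_neq0 //.
  apply: cmv_const_neq0 => //.
  - by rewrite /= /ext_ac conjC1.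
  - by move=> k; rewrite /= gt_eqF // rho_gt0.
  move=> k; have := ext_unitary a (horner_eval 0 : {rmorphism {poly C} -> C}) k.
  by rewrite /= !horner_evalE !hornerC.
by rewrite gt_eqF // defect_gt0.
Qed.

Lemma char_poly_Umx n : S n \in unitmx ->
  (\det (S n))%:P * char_poly (Umx alpha a n) = \det (pencil n).
Proof.
move=> Su; have Hu : H n \in unitmx.
  by apply: diag_row_of_nat_unit => k; rewrite gt_eqF // defect_gt0.
have UE : Umx alpha a n *m (invmx (H n) *m S n) = invmx (H n) *m (F n + A n).
  by rewrite Umx_diag !mulmxA mulmxK // mulmxKV.
have : char_poly_mx (Umx alpha a n) *m map_mx polyC (invmx (H n) *m S n)
    = map_mx polyC (invmx (H n)) *m pencil n.
  rewrite /char_poly_mx mulmxBl mul_scalar_mx -map_mxM UE mulmxBr -scalemxAr.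
  by rewrite -!map_mxM.
move/(congr1 determinant); rewrite !det_mulmx map_mxM det_mulmx.
rewrite mulrCA => /mulfI <-; last first.
  by rewrite det_map_mx polyC_eq0 det_inv invr_eq0 -unitfE -unitmxE.
by rewrite det_map_mx mulrC.
Qed.

End CharPoly.

Section MoebiusEigenvectors.
Variables (K : fieldType) (n : nat) (U S G F V Z D E H : 'M[K]_n) (l : K).
Hypotheses (H_unit : H \in unitmx) (S_unit : S \in unitmx) (V_unit : V \in unitmx).
Hypothesis U_mul : U *m (invmx H *m S) = invmx H *m G.
Hypothesis G_sub : G - l *: S = V *m (F - Z).

Lemma left_moebius_eigenvector (x : 'rV[K]_n) : D = invmx H *m V ->
  x *m U = l *: x <-> x *m D *m F = x *m D *m Z.
Proof.
move=> ->; have HSu : invmx H *m S \in unitmx.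
  by rewrite unitmx_mul unitmx_inv H_unit S_unit.
have key : x *m invmx H *m G - l *: (x *m invmx H *m S)
    = x *m (invmx H *m V) *m F - x *m (invmx H *m V) *m Z.
  by rewrite scalemxAr -mulmxBr G_sub -mulmxBr !mulmxA.
split=> [xU|e].
  apply/eqP; rewrite -subr_eq0 -key subr_eq0; apply/eqP.
  by rewrite -mulmxA -U_mul mulmxA xU -scalemxAl mulmxA.
apply: (can_inj (mulmxK HSu)); rewrite -mulmxA U_mul -scalemxAl !mulmxA.
by apply/eqP; rewrite -subr_eq0 key e subrr.
Qed.

Lemma right_moebius_eigenvector (y : 'cV[K]_n) : E *m D = H ->
    (forall w : 'cV[K]_n, F *m w = Z *m w -> S *m w = E *m w) ->
  U *m y = l *: y <-> F *m (D *m y) = Z *m (D *m y).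
Proof.
move=> ED SE; have GE (w : 'cV[K]_n) : F *m w = Z *m w <-> G *m w = l *: (S *m w).
  have key : G *m w - l *: (S *m w) = V *m (F *m w - Z *m w).
    by rewrite scalemxAl -!mulmxBl G_sub mulmxA.
  split=> e; apply/eqP; rewrite -subr_eq0.
    by rewrite key e subrr mulmx0.
  by rewrite -[X in X == 0](mulKmx V_unit) -key e subrr mulmx0.
split=> [Uy|e].
  pose w := invmx S *m (H *m y).
  have yE : y = invmx H *m S *m w.
    by rewrite /w mulmxA mulmxK // mulKmx.
  have Fw : F *m w = Z *m w.
    apply/GE; apply: (can_inj (mulKVmx H_unit)).
    by rewrite mulmxA -U_mul -mulmxA -yE Uy yE -mulmxA scalemxAr.
  suff -> : D *m y = w by [].
  have HED : invmx H *m E *m D = 1%:M by rewrite -mulmxA ED mulVmx.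
  rewrite yE -(mulmxA _ S) (SE _ Fw) (mulmxA _ E) (mulmxA D) (mulmx1C HED).
  by rewrite mul1mx.
have {1}-> : y = invmx H *m S *m (D *m y).
  by rewrite -mulmxA (SE _ e) (mulmxA E) ED mulKmx.
rewrite (mulmxA U) U_mul -mulmxA ((GE _).1 e) -scalemxAr (SE _ e).
by rewrite (mulmxA E) ED mulKmx.
Qed.

End MoebiusEigenvectors.

Section Eigenvectors.
Variable R : realType.
Local Notation C := R[i].
Variables (alpha a : nat -> C).
Hypothesis alpha0 : alpha 0%N = 0.
Hypothesis alpha_lt1 : forall n, `|alpha n| < 1.
Hypothesis a_lt1 : forall n, `|a n.+1| < 1.
Variable l : C.
Hypothesis l_lt1 : `|l| < 1.
Variable m : nat.
Local Notation n := m.+1.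

Local Notation dg w := (diag_mx (row_of_nat n w)).
Local Notation U := (Umx alpha a n).
Local Notation F := (principal (Cmx a) n).
Local Notation S := (1%:M + dg (fun k => (alpha k)^*) *m F).
Local Notation f := (horner_eval l : {rmorphism {poly C} -> C}).
Local Notation v k := (varpi alpha k).[l].
Local Notation D := (dg (fun k => v k / defect alpha k)).
Local Notation Z := (dg (zeta_of alpha f)).

Let d0 k : defect alpha k != 0. Proof. by rewrite gt_eqF // defect_gt0. Qed.
Let v0 k : v k != 0. Proof. exact: varpi_neq0_in. Qed.

Lemma moebius_denom_unit : S \in unitmx.
Proof. by rewrite unitmxE unitfE det_moebius_denom_neq0. Qed.

Lemma diag_defect_unit : dg (defect alpha) \in unitmx.
Proof. exact: diag_row_of_nat_unit. Qed.

Lemma diag_normalizer_unit : D \in unitmx.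
Proof. by apply: diag_row_of_nat_unit => k; rewrite mulf_neq0 ?invr_neq0. Qed.

Lemma eq_diag_row (w w' : nat -> C) : w =1 w' -> dg w = dg w'.
Proof. by move=> ww; congr diag_mx; apply/rowP=> j; rewrite !mxE ww. Qed.

Lemma diag_row1 : dg (fun=> 1 : C) = 1%:M.
Proof. by apply/matrixP=> i j; rewrite !mxE. Qed.

Lemma Umx_mul_denom : U *m (invmx (dg (defect alpha)) *m S)
  = invmx (dg (defect alpha)) *m (F + dg alpha).
Proof. by rewrite Umx_diag !mulmxA mulmxK ?diag_defect_unit // mulmxKV ?moebius_denom_unit. Qed.

Lemma invmx_diag_defect : invmx (dg (defect alpha)) = dg (fun k => (defect alpha k)^-1).
Proof.
have e : dg (defect alpha) *m dg (fun k => (defect alpha k)^-1) = 1%:M.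
  by rewrite mul_diag_row_of_nat -diag_row1; apply: eq_diag_row => k; rewrite divff.
by rewrite -[LHS]mulmx1 -e mulmxA mulVmx ?diag_defect_unit // mul1mx.
Qed.

Lemma diag_varpi_zeta : dg (fun k => v k) *m Z = dg (fun k => (varpistar alpha k).[l]).
Proof.
rewrite mul_diag_row_of_nat; apply: eq_diag_row => k.
by rewrite /zeta_of /= !horner_evalE mulrCA divff ?mulr1.
Qed.

Lemma pencil_split : F + dg alpha - l *: S = dg (fun k => v k) *m (F - Z).
Proof.
rewrite mulmxBr diag_varpi_zeta !mul_diag_mx; apply/matrixP=> i j.
rewrite !mxE horner_varpi horner_varpistar.
by case: (i == j); rewrite ?mulr1n ?mulr0n; ring.
Qed.

Lemma left_eigenvectorE (x : 'rV[C]_n) :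
  x *m U = l *: x <-> x *m D *m F = x *m D *m Z.
Proof.
apply: (left_moebius_eigenvector diag_defect_unit moebius_denom_unit Umx_mul_denom pencil_split).
rewrite invmx_diag_defect mul_diag_row_of_nat.
by apply: eq_diag_row => k; rewrite mulrC.
Qed.

Lemma right_eigenvectorE (y : 'cV[C]_n) :
  U *m y = l *: y <-> F *m (D *m y) = Z *m (D *m y).
Proof.
apply: (right_moebius_eigenvector diag_defect_unit moebius_denom_unit _ Umx_mul_denom pencil_split
  (E := dg (fun k => defect alpha k ^+ 2 / v k))).
- exact: diag_row_of_nat_unit.
- rewrite mul_diag_row_of_nat; apply: eq_diag_row => k.
  have := d0 k; have := v0 k; move: (v k) (defect _ k) => x d x0 e0.
  by field; rewrite x0 e0.
move=> w Fw; rewrite mulmxDl mul1mx -mulmxA Fw mulmxA -{1}[w]mul1mx -mulmxDl.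
congr (_ *m _); rewrite mul_diag_row_of_nat -diag_row1; apply/matrixP=> i j.
rewrite !mxE -mulrnDl; congr (_ *+ _).
rewrite /zeta_of /= !horner_evalE horner_varpistar /defect sqrtCK normCK.
by have := v0 i; rewrite horner_varpi => vi; field.
Qed.

Let f_v k : f (varpi alpha k) != 0. Proof. exact: v0. Qed.

Lemma normal_orf_star_neq0 k : normal_orf alpha f (orf_num_star alpha a) k != 0.
Proof.
have pk : f (pi_ alpha k) != 0 by apply: rmorph_pi_neq0.
have dk : f (defect alpha k)%:P != 0 by apply: rmorph_defect_neq0.
have qk : f (orf_num_star alpha a k) != 0 by apply: orf_num_star_neq0_in.
by rewrite /normal_orf mulf_neq0 // mulf_neq0 ?invr_neq0.
Qed.

Local Notation w b := (null_vec (zeta_of alpha f) (normal_orf alpha f (orf_num alpha a))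
                            (normal_orf alpha f (orf_num_star alpha a)) b n).

Lemma cmv_null_vectorP b (W : 'rV[C]_n) : root (orf_num alpha a n) l ->
  W *m (blockmx (ext_a a) (ext_ac a) (ext_rho a) b n
        *m blockmx (ext_a a) (ext_ac a) (ext_rho a) (~~ b) n) = W *m Z
  <-> exists c, W = c *: row_of_nat n (w b).
Proof.
move=> pn.
have cE (x : C) : (f \o polyC) x = x by rewrite /= horner_evalE hornerC.
apply: (@null_vectorP _ (ext_a a) (ext_ac a) (ext_rho a) _ _ _ _ _ _ _ _ _ _ b).
- by rewrite /ext_ac conjC1.
- by [].
- by move=> k; rewrite gt_eqF // rho_gt0.
- exact: (normal_orf0 alpha0 f (erefl : orf_num alpha a 0 = 1)).
- exact: (normal_orf0 alpha0 f (erefl : orf_num_star alpha a 0 = 1)).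
- by move=> k; rewrite (zeta_normal_orf alpha_lt1 a_lt1 f_v) !cE.
- by move=> k; rewrite (normal_orf_starS alpha_lt1 a_lt1 f_v) !cE.
- exact: normal_orf_star_neq0.
by rewrite /normal_orf /= horner_evalE (rootP pn) !mul0r.
Qed.

Lemma left_eigenspaceP (X x : 'rV[C]_n) : root (orf_num alpha a n) l ->
  X *m D = row_of_nat n (w false) ->
  x *m U = l *: x <-> exists c, x = c *: X.
Proof.
move=> pn XD; rewrite left_eigenvectorE principal_Cmx (cmv_null_vectorP false _ pn) -XD.
split=> -[c xE]; exists c; last by rewrite xE scalemxAl.
by apply: (can_inj (mulmxK diag_normalizer_unit)); rewrite xE scalemxAl.
Qed.

Lemma right_eigenspaceP (Y : 'rV[C]_n) (y : 'cV[C]_n) :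
  root (orf_num alpha a n) l -> Y *m D = row_of_nat n (w true) ->
  U *m y = l *: y <-> exists c, y = c *: Y^T.
Proof.
move=> pn YD; rewrite right_eigenvectorE principal_Cmx.
have trE : (D *m y)^T = y^T *m D by rewrite trmx_mul tr_diag_mx.
have -> : (blockmx (ext_a a) (ext_ac a) (ext_rho a) false n
      *m blockmx (ext_a a) (ext_ac a) (ext_rho a) true n *m (D *m y)
      = Z *m (D *m y)) <->
    (y^T *m D *m (blockmx (ext_a a) (ext_ac a) (ext_rho a) true n
      *m blockmx (ext_a a) (ext_ac a) (ext_rho a) (~~ true) n) = y^T *m D *m Z).
  rewrite -trE; move: (D *m y) => W; split=> [/(congr1 trmx)|eT].
    by rewrite !trmx_mul !blockmx_tr tr_diag_mx.
  by apply: trmx_inj; rewrite !trmx_mul !blockmx_tr tr_diag_mx.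
rewrite (cmv_null_vectorP true _ pn) -YD; split=> -[c yE]; exists c.
  apply: trmx_inj; apply: (can_inj (mulmxK diag_normalizer_unit)).
  by rewrite yE linearZ /= trmxK scalemxAl.
by rewrite yE linearZ /= trmxK scalemxAl.
Qed.

End Eigenvectors.

(** * Rational functions *)

Section Star.
Variables (C : numClosedFieldType) (K : fieldType) (f : {rmorphism {poly C} -> K}).
Hypothesis f_inj : injective f.

Definition star_coef : C -> K := (f \o polyC) \o Num.conj.

HB.instance Definition _ := GRing.RMorphism.on star_coef.

Definition star : {poly C} -> K := horner_eval (f 'X)^-1 \o map_poly star_coef.

HB.instance Definition _ := GRing.RMorphism.on star.

Lemma starE p : star p = \sum_(i < size p) f ((p`_i)^*)%:P / f 'X ^+ i.
Proof.
rewrite /star /= horner_evalE horner_coef size_map_poly.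
by apply: eq_bigr => i _; rewrite coef_map /= exprVn.
Qed.

Lemma starC x : star x%:P = f (x^*)%:P.
Proof. by rewrite /star /= map_polyC /= horner_evalE hornerC. Qed.

Lemma starX : star 'X = (f 'X)^-1.
Proof. by rewrite /star /= map_polyX horner_evalE hornerX. Qed.

Definition conj_rev (p : {poly C}) : {poly C} :=
  \sum_(i < size p) (p`_i)^* *: 'X^((size p).-1 - i).

Lemma inj_rmorph_neq0 p : p != 0 -> f p != 0.
Proof. by apply: contra_neq => fp; apply: f_inj; rewrite fp rmorph0. Qed.

Let fX : f 'X != 0. Proof. by rewrite inj_rmorph_neq0 ?polyX_eq0. Qed.

Lemma conj_rev_neq0 p : p != 0 -> conj_rev p != 0.
Proof.
move=> p0; apply/eqP=> /(congr1 (fun q => q.[0])); rewrite horner0 horner_sum.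
have sp : (0 < size p)%N by rewrite size_poly_gt0.
have lt : ((size p).-1 < size p)%N by rewrite prednK.
rewrite (bigD1 (Ordinal lt)) //= subnn expr0 hornerZ hornerC mulr1 big1 => [|i].
  by rewrite addr0 => /eqP; rewrite conjC_eq0 -lead_coefE lead_coef_eq0 (negbTE p0).
rewrite -val_eqE /= => ip; rewrite hornerZ hornerXn expr0n.
by rewrite subn_eq0 leqNgt ltn_neqAle ip -ltnS prednK // ltn_ord mulr0.
Qed.

Lemma f_conj_rev p : f (conj_rev p) = star p * f 'X ^+ (size p).-1.
Proof.
rewrite starE rmorph_sum mulr_suml; apply: eq_bigr => i _.
rewrite -mul_polyC rmorphM rmorphXn mulrAC -mulrA; congr (_ * _).
have ip : (i <= (size p).-1)%N.
  by rewrite -ltnS prednK ?ltn_ord //; apply: leq_ltn_trans (ltn_ord i).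
by rewrite expfB_cond // (negbTE fX).
Qed.

Lemma star_conj_rev p : star (conj_rev p) * f 'X ^+ (size p).-1 = f p.
Proof.
rewrite rmorph_sum mulr_suml -[in RHS](coefK p) poly_def rmorph_sum.
apply: eq_bigr => i _; rewrite -!mul_polyC !rmorphM !rmorphXn /= starC conjCK starX.
have ip : (i <= (size p).-1)%N.
  by rewrite -ltnS prednK ?ltn_ord //; apply: leq_ltn_trans (ltn_ord i).
rewrite -mulrA; congr (_ * _); rewrite exprVn mulrC -expfB_cond ?subKn //.
by rewrite (negbTE fX) leq_subr.
Qed.

Lemma star_neq0 p : p != 0 -> star p != 0.
Proof.
move=> p0; have := inj_rmorph_neq0 (conj_rev_neq0 p0).
by rewrite f_conj_rev mulf_eq0 => /norP[].
Qed.

Definition star_num (p q : {poly C}) : {poly C} :=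
  conj_rev p * 'X^((size q).-1).

Lemma star_num_neq0 p q : p != 0 -> star_num p q != 0.
Proof. by move=> p0; rewrite mulf_neq0 ?conj_rev_neq0 // expf_neq0 ?polyX_eq0. Qed.

Lemma star_frac p q : star p / star q = f (star_num p q) / f (star_num q p).
Proof.
have x0 k : f 'X ^+ k != 0 by rewrite expf_neq0.
rewrite !rmorphM !rmorphXn !f_conj_rev -(mulrA (star p)) -(mulrA (star q)).
rewrite (mulrC (f 'X ^+ (size q).-1)) -mulf_div divff ?mulr1 //.
by rewrite mulf_neq0.
Qed.

Lemma star_star_num p q :
  star (star_num p q) / star (star_num q p) = f p / f q.
Proof.
have x0 k : f 'X ^+ k != 0 by rewrite expf_neq0.
rewrite -(star_conj_rev p) -(star_conj_rev q) !rmorphM !rmorphXn /= starX.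
rewrite -!mulf_div; congr (_ * _).
by rewrite !exprVn invrK mulrC.
Qed.

End Star.

Lemma pi_ratio (I : idomainType) (x : {ratio I}) :
  (\pi_({fraction I}) x = FracField.tofrac (frac x).1 / FracField.tofrac (frac x).2)%qT.
Proof.
have d0 := denom_ratioP x; apply: (@mulIf _ (FracField.tofrac (frac x).2)).
  by rewrite tofrac_eq0.
rewrite divfK ?tofrac_eq0 //; unlock FracField.tofrac; rewrite -[LHS]FracField.pi_mul.
apply/eqmodP; rewrite /= FracField.equivfE /FracField.mulf.
by rewrite !numden_Ratio ?mulf_neq0 ?oner_neq0 // !mulr1 mulrC.
Qed.

Section Rational.
Variable R : realType.
Local Notation C := R[i].
Local Notation f := (@FracField.tofrac {poly C} : {rmorphism {poly C} -> {fraction {poly C}}}).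

Lemma polyf_inj : injective f.
Proof. by move=> p q /eqP; rewrite tofrac_eq => /eqP. Qed.

Lemma rnum_rden (g : ratfun R) :
  [/\ rden g != 0, coprimep (rnum g) (rden g) & g = f (rnum g) / f (rden g)].
Proof.
rewrite /rnum /rden; set x := repr g.
have d0 : (frac x).2 != 0 by apply: denom_ratioP.
set p := (frac x).1; set q := (frac x).2; set d := gcdp p q.
have dn0 : d != 0 by rewrite gcdp_eq0 negb_and d0 orbT.
have qE : q = q %/ d * d by rewrite divpK ?dvdp_gcdr.
have pE : p = p %/ d * d by rewrite divpK ?dvdp_gcdl.
have qd0 : q %/ d != 0 by apply: contraNneq d0 => e; rewrite -/q qE e mul0r.
split=> //; first by rewrite coprimep_div_gcd // d0 orbT.
rewrite -[LHS]reprK pi_ratio -/x -/p -/q {1}pE {1}qE !tofracM.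
by rewrite -mulf_div divff ?mulr1 // tofrac_eq0.
Qed.

Lemma frac_eq (p q p' q' : {poly C}) : q != 0 -> q' != 0 ->
  (f p / f q == f p' / f q') = (p * q' == p' * q).
Proof.
move=> q0 q'0; rewrite eqr_div ?tofrac_eq0 //.
by rewrite -!tofracM tofrac_eq.
Qed.

Lemma polystarE (p : {poly C}) : polystar p = star f p.
Proof. by rewrite starE. Qed.

Lemma rstar_frac (p q : {poly C}) : q != 0 ->
  rstar (f p / f q) = star f p / star f q.
Proof.
move=> q0; rewrite /rstar !polystarE; have [d0 _ gE] := rnum_rden (f p / f q).
move/eqP: gE; rewrite frac_eq // => /eqP e; apply/eqP.
rewrite eqr_div ?(star_neq0 polyf_inj) //.
by rewrite -!rmorphM -e.
Qed.

Lemma ratfun_ind (P : ratfun R -> Prop) :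
  (forall p q, q != 0 -> P (f p / f q)) -> forall g, P g.
Proof. by move=> H g; have [d0 _ ->] := rnum_rden g; apply: H. Qed.

Lemma rstarM : {morph @rstar R : g h / g * h >-> g * h}.
Proof.
move=> g h; elim/ratfun_ind: g => p q q0; elim/ratfun_ind: h => p' q' q'0.
by rewrite mulf_div -!tofracM !rstar_frac ?mulf_neq0 // !rmorphM mulf_div.
Qed.

Lemma rstar1 : rstar (1 : ratfun R) = 1.
Proof.
rewrite -[1 in LHS]divr1 -(tofrac1 {poly C}) rstar_frac ?oner_neq0 //.
by rewrite rmorph1 divr1.
Qed.

Lemma rstar0 : rstar (0 : ratfun R) = 0.
Proof.
have := rstar_frac 0 (oner_neq0 {poly C}).
by rewrite (rmorph0 f) (rmorph0 (star f)) !mul0r.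
Qed.

Lemma rstarV (g : ratfun R) : rstar g^-1 = (rstar g)^-1.
Proof.
elim/ratfun_ind: g => p q q0; rewrite invf_div.
have [->|p0] := eqVneq p 0; last by rewrite !rstar_frac // invf_div.
by rewrite rmorph0 invr0 mulr0 mul0r rstar0 invr0.
Qed.

Lemma rstarK : involutive (@rstar R).
Proof.
move=> g; elim/ratfun_ind: g => p q q0; rewrite rstar_frac //.
have [->|p0] := eqVneq p 0.
  by rewrite !rmorph0 !mul0r rstar0.
rewrite (star_frac polyf_inj) rstar_frac ?star_num_neq0 //.
exact: (star_star_num polyf_inj).
Qed.

End Rational.

Section ParityProducts.
Variables (K : comNzRingType) (z : nat -> K).

Definition parity_prod b j := \prod_(1 <= l < j.+1 | starred b l) z l.

Lemma parity_prodS b j : parity_prod b j.+1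
  = parity_prod b j * (if starred b j.+1 then z j.+1 else 1).
Proof. by rewrite /parity_prod big_mkcond big_nat_recr //= -big_mkcond. Qed.

Lemma parity_prod_even j : parity_prod false j = \prod_(i < j./2) z i.*2.+2.
Proof.
elim: j => [|j IHj]; first by rewrite /parity_prod big_geq // big_ord0.
rewrite parity_prodS IHj /= uphalf_half /starred /=.
case: (boolP (odd j)) => [jo|_] /=; last by rewrite mulr1.
by rewrite add1n big_ord_recr /=; congr (_ * z _); lia.
Qed.

Lemma parity_prod_odd j : parity_prod true j = \prod_(i < uphalf j) z i.*2.+1.
Proof.
elim: j => [|j IHj]; first by rewrite /parity_prod big_geq // big_ord0.
rewrite parity_prodS IHj /= uphalf_half /starred /=.
case: (boolP (odd j)) => [jo|je] /=; first by rewrite mulr1.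
by rewrite big_ord_recr /=; congr (_ * z _); lia.
Qed.

Lemma parity_prod_split j :
  \prod_(1 <= l < j.+1) z l = parity_prod false j * parity_prod true j.
Proof.
rewrite (bigID (starred false)); congr (_ * _); apply: eq_bigl => l.
by rewrite /starred; case: odd.
Qed.

Lemma parity_prod_cat b n j : (j < n.+1)%N ->
  parity_prod b n = parity_prod b j * \prod_(j.+1 <= l < n.+1 | starred b l) z l.
Proof.
by move=> jn; rewrite /parity_prod [LHS]big_mkcond (@big_cat_nat _ _ _ j.+1) //
  -!big_mkcond.
Qed.

End ParityProducts.

Lemma mulf_invMl (K : fieldType) (x y : K) : x != 0 -> x * (x * y)^-1 = y^-1.
Proof. by move=> x0; rewrite invfM mulrA divff // mul1r. Qed.

Lemma mulf_invMr (K : fieldType) (x y w : K) : y != 0 -> y^-1 * (x * y * w) = x * w.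
Proof. by move=> y0; rewrite [x * y]mulrC -mulrA mulKf. Qed.

Section ValueAt.
Variable R : realType.
Local Notation C := R[i].
Local Notation f := (@FracField.tofrac {poly C} : {rmorphism {poly C} -> {fraction {poly C}}}).

Definition val_at (l : C) (g : ratfun R) (x : C) : Prop :=
  exists p q : {poly C}, [/\ q.[l] != 0, g = f p / f q & x = p.[l] / q.[l]].

Lemma horner_neq0 (q : {poly C}) l : q.[l] != 0 -> q != 0.
Proof. by apply: contra_neq => ->; rewrite horner0. Qed.

Lemma coprimep_root_neq0 (p q : {poly C}) l :
  coprimep p q -> root p l -> q.[l] != 0.
Proof. by move=> cpq rp; apply: (coprimep_root cpq). Qed.

Lemma reval_val l g x : val_at l g x -> reval g l = x.
Proof.
case=> p [q [ql gE ->]]; have [d0 cop gE'] := rnum_rden g.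
have /eqP := etrans (esym gE') gE; rewrite frac_eq ?(horner_neq0 ql) // => /eqP e.
have {}e : (rnum g).[l] * q.[l] = p.[l] * (rden g).[l] by rewrite -!hornerM e.
have dl : (rden g).[l] != 0.
  apply/negP=> dl0; have nl0 : root (rnum g) l.
    by move/eqP: e; rewrite (eqP dl0) mulr0 mulf_eq0 (negbTE ql) orbF.
  by have := coprimep_root_neq0 cop nl0; rewrite dl0.
by apply/eqP; rewrite /reval eqr_div // e.
Qed.

Lemma rzero_frac (p q : {poly C}) l : q != 0 ->
    (forall x, root p x -> q.[x] != 0) ->
  rzero (f p / f q) l = root p l.
Proof.
move=> q0 pq; rewrite /rzero; have [d0 cop /eqP] := rnum_rden (f p / f q).
rewrite frac_eq // => /eqP e.
have {}e : p.[l] * (rden (f p / f q)).[l] = (rnum (f p / f q)).[l] * q.[l].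
  by rewrite -!hornerM e.
apply/idP/idP=> [rl|pl].
  move: e; rewrite (rootP rl) mul0r => /eqP.
  by rewrite mulf_eq0 (negbTE (coprimep_root_neq0 cop rl)) orbF.
move: e; rewrite (rootP pl) mul0r => /esym/eqP.
by rewrite mulf_eq0 (negbTE (pq l pl)) orbF.
Qed.

Lemma val_at_frac l (p q : {poly C}) : q.[l] != 0 ->
  val_at l (f p / f q) (p.[l] / q.[l]).
Proof. by move=> ql; exists p, q. Qed.

Lemma val_at1 l : val_at l 1 1.
Proof.
by exists 1, 1; rewrite hornerC oner_neq0 (rmorph1 f) !divr1.
Qed.

Lemma val_atM l g h x y : val_at l g x -> val_at l h y -> val_at l (g * h) (x * y).
Proof.
move=> [p [q [q0 -> ->]]] [p' [q' [q'0 -> ->]]].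
exists (p * p'), (q * q'); rewrite !hornerM !(rmorphM f) !mulf_div.
by rewrite mulf_neq0.
Qed.

Lemma val_at_prod l (I : Type) (r : seq I) (P : pred I) (g : I -> ratfun R)
    (x : I -> C) : (forall i, val_at l (g i) (x i)) ->
  val_at l (\prod_(i <- r | P i) g i) (\prod_(i <- r | P i) x i).
Proof.
move=> gx; elim/big_rec2: _ => [|i y h _ hy]; first exact: val_at1.
exact: val_atM.
Qed.

End ValueAt.

Section OrfStep.
Variables (R : realType) (alpha a : nat -> R[i]) (K : fieldType).
Variable f : {rmorphism {poly R[i]} -> K}.
Hypothesis f_varpi : forall k, f (varpi alpha k) != 0.

Lemma orf_num_step k : f (e_ alpha a k.+1)%:P
    * (f (varpi alpha k) / f (varpi alpha k.+1))
    * (zeta_of alpha f k * (f (orf_num alpha a k) / f (pi_ alpha k))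
       + f (a k.+1)%:P * (f (orf_num_star alpha a k) / f (pi_ alpha k)))
  = f (orf_num alpha a k.+1) / f (pi_ alpha k.+1).
Proof.
rewrite /zeta_of pi_recr orf_numS -!mul_polyC (rmorphM f _%:P).
rewrite (rmorphD f (varpistar alpha k * _)) !(rmorphM f).
move: (rmorph_pi_neq0 f_varpi k) (f_varpi k) (f_varpi k.+1).
move: (f (pi_ alpha k)) (f (varpi alpha k)) (f (varpi alpha k.+1))
  (f (varpistar alpha k)) (f (e_ _ _ _)%:P) (f (a _)%:P) (f (orf_num _ _ _))
  (f (orf_num_star _ _ _)) => g v v' vs e b x y g0 v0 v'0.
by field; rewrite g0 v0 v'0.
Qed.

Lemma orf_num_star_step k : f (e_ alpha a k.+1)%:P
    * (f (varpi alpha k) / f (varpi alpha k.+1))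
    * (f ((a k.+1)^*)%:P * (zeta_of alpha f k * (f (orf_num alpha a k) / f (pi_ alpha k)))
       + f (orf_num_star alpha a k) / f (pi_ alpha k))
  = f (orf_num_star alpha a k.+1) / f (pi_ alpha k.+1).
Proof.
rewrite /zeta_of pi_recr orf_num_starS -!mul_polyC (rmorphM f _%:P).
rewrite (rmorphD f (_ * (varpistar alpha k * _))) !(rmorphM f).
move: (rmorph_pi_neq0 f_varpi k) (f_varpi k) (f_varpi k.+1).
move: (f (pi_ alpha k)) (f (varpi alpha k)) (f (varpi alpha k.+1))
  (f (varpistar alpha k)) (f (e_ _ _ _)%:P) (f (_^*)%:P) (f (orf_num _ _ _))
  (f (orf_num_star _ _ _)) => g v v' vs e b x y g0 v0 v'0.
by field; rewrite g0 v0 v'0.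
Qed.

Hypothesis f_inj : injective f.

Lemma star_varpistar k : star f (varpistar alpha k) = f (varpi alpha k) / f 'X.
Proof.
have fX : f 'X != 0 by rewrite (inj_rmorph_neq0 f_inj) ?polyX_eq0.
rewrite rmorphB /= starX starC /varpi -mul_polyC (rmorphB f) (rmorphM f) rmorph1.
by rewrite mulrBl mulfK // div1r.
Qed.

Lemma star_varpi k : star f (varpi alpha k) = f (varpistar alpha k) / f 'X.
Proof.
have fX : f 'X != 0 by rewrite (inj_rmorph_neq0 f_inj) ?polyX_eq0.
rewrite /varpi -mul_polyC rmorphB rmorphM rmorph1 /= starX starC conjCK.
by rewrite (rmorphB f) mulrBl divff.
Qed.

End OrfStep.

Section Orf.
Variables (R : realType) (mu : probability (borel_circle R) R).
Local Notation C := R[i].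
Variables (alpha a : nat -> C) (phi : nat -> ratfun R).
Hypothesis alpha0 : alpha 0%N = 0.
Hypothesis alpha_lt1 : forall n, `|alpha n| < 1.
Hypothesis a_lt1 : forall n, `|a n.+1| < 1.
Hypothesis orf : is_ORF mu alpha phi a.
Local Notation f := (@FracField.tofrac {poly C} : {rmorphism {poly C} -> {fraction {poly C}}}).
Local Notation z := (zeta alpha).

Let f_varpi k : f (varpi alpha k) != 0.
Proof. by rewrite tofrac_eq0 varpi_neq0. Qed.

Lemma phi_frac k : phi k = f (orf_num alpha a k) / f (pi_ alpha k)
  /\ superstar alpha k (phi k) = f (orf_num_star alpha a k) / f (pi_ alpha k).
Proof.
elim: k => [|k [IHp IHq]].
  rewrite (ORF_0 orf) /superstar /B big_geq // mul1r rstar1 /pi_ big_geq //.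
  by rewrite divff ?(rmorph1 f) ?oner_neq0.
split.
  by rewrite (ORF_rec orf) // IHp -IHp IHq -(orf_num_step a f_varpi) -IHp.
rewrite (ORF_rec_star orf) // -(orf_num_star_step a f_varpi) -IHp -IHq.
by [].
Qed.

Let zeta_neq0 k : z k != 0.
Proof.
rewrite mulf_neq0 ?invr_neq0 //; first by rewrite tofrac_eq0 polyXsubC_eq0.
exact: f_varpi.
Qed.

Lemma parity_prod_zeta_neq0 b j : parity_prod z b j != 0.
Proof. by rewrite prodf_seq_neq0; apply/allP=> l _; rewrite zeta_neq0 implybT. Qed.

Lemma rstar_zeta k : rstar (z k) = (z k)^-1.
Proof.
rewrite /zeta rstar_frac ?varpi_neq0 //.
rewrite (star_varpistar _ (@polyf_inj R)) (star_varpi _ (@polyf_inj R)).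
have fX : f 'X != 0 by rewrite tofrac_eq0 polyX_eq0.
by rewrite invf_div [RHS]invf_div mulrA divfK.
Qed.

Lemma rstar_parity_prod b j : rstar (parity_prod z b j) = (parity_prod z b j)^-1.
Proof.
rewrite /parity_prod (big_morph _ (@rstarM R) (@rstar1 R)) -prodfV.
by apply: eq_bigr => l _; rewrite rstar_zeta.
Qed.

Lemma B_split j : B alpha j = parity_prod z false j * parity_prod z true j.
Proof. exact: parity_prod_split. Qed.

Lemma chiE j : chi alpha phi j = (parity_prod z false j)^-1
  * (if odd j then phi j else superstar alpha j (phi j)).
Proof.
by rewrite /chi /Be -(parity_prod_even z) rstar_parity_prod.
Qed.

Lemma rstar_chi j : rstar (chi alpha phi j) = (parity_prod z true j)^-1
  * (if odd j then superstar alpha j (phi j) else phi j).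
Proof.
have e0 := parity_prod_zeta_neq0 false j; have o0 := parity_prod_zeta_neq0 true j.
have BE : parity_prod z false j * rstar (B alpha j) = (parity_prod z true j)^-1.
  by rewrite B_split rstarM !rstar_parity_prod -invfM (mulf_invMl _ e0).
have phiE : parity_prod z false j * rstar (phi j)
    = (parity_prod z true j)^-1 * superstar alpha j (phi j).
  by rewrite /superstar B_split (mulf_invMr _ _ o0).
rewrite chiE rstarM rstarV rstar_parity_prod invrK; case: odd; first exact: phiE.
by rewrite /superstar rstarM rstarK mulrA BE.
Qed.

Definition orf_alt b j := if starred b j then superstar alpha j (phi j) else phi j.

Lemma Xvec_entry m (j : 'I_m.+1) :
  Xvec alpha phi m.+1 0 j = starred_prod z false m.+1 j * orf_alt false j.
Proof.
rewrite mxE chiE /Be -(parity_prod_even z) (parity_prod_cat z false (ltn_ord j)).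
rewrite /starred_prod /orf_alt /starred eqbF_neg if_neg [parity_prod _ _ _ * _]mulrC.
by rewrite -mulrA mulVKf // parity_prod_zeta_neq0.
Qed.

Lemma Yvec_entry m (j : 'I_m.+1) :
  Yvec alpha phi m.+1 0 j = starred_prod z true m.+1 j * orf_alt true j.
Proof.
rewrite mxE rstar_chi /Bo -(parity_prod_odd z m) (parity_prod_cat z true (ltn_ord j)).
rewrite /starred_prod /orf_alt /starred eqb_id [parity_prod _ _ _ * _]mulrC.
by rewrite -mulrA mulVKf // parity_prod_zeta_neq0.
Qed.

Section Evaluation.
Variable l : C.
Hypothesis l_lt1 : `|l| < 1.
Local Notation h := (horner_eval l : {rmorphism {poly C} -> C}).

Let h_varpi k : h (varpi alpha k) != 0. Proof. exact: varpi_neq0_in. Qed.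

Lemma val_at_entry b n j : val_at l (starred_prod z b n j * orf_alt b j)
  (starred_prod (zeta_of alpha h) b n j * (if starred b j
     then (orf_num_star alpha a j).[l] / (pi_ alpha j).[l]
     else (orf_num alpha a j).[l] / (pi_ alpha j).[l])).
Proof.
have pl k : (pi_ alpha k).[l] != 0 by apply: (rmorph_pi_neq0 h_varpi).
have [pE qE] := phi_frac j.
apply: val_atM; last first.
  by rewrite /orf_alt; case: ifP => _; rewrite ?qE ?pE; apply: val_at_frac.
apply: val_at_prod => k; rewrite /zeta /zeta_of /= !horner_evalE.
exact/val_at_frac/varpi_neq0_in.
Qed.

Lemma rveval_row b m (v : 'rV[ratfun R]_m.+1) :
  (forall j, v 0 j = starred_prod z b m.+1 j * orf_alt b j) ->
  rveval v l *m diag_mx (row_of_nat m.+1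
      (fun k => (varpi alpha k).[l] / defect alpha k))
  = row_of_nat m.+1 (null_vec (zeta_of alpha h) (normal_orf alpha h (orf_num alpha a))
      (normal_orf alpha h (orf_num_star alpha a)) b m.+1).
Proof.
move=> vE; rewrite mul_mx_diag; apply/rowP=> j; rewrite !mxE vE.
rewrite (reval_val (val_at_entry b m.+1 j)) /null_vec -mulrA; congr (_ * _).
by case: ifP => _; rewrite /normal_orf /= !horner_evalE hornerC.
Qed.

End Evaluation.

Lemma root_orf_num_lt1 k l : root (orf_num alpha a k) l -> `|l| < 1.
Proof.
move=> rl; rewrite real_ltNge ?realE ?normr_ge0 ?ler01 //.
by apply: contraL rl; apply: orf_num_neq0_out.
Qed.

Lemma rzero_phi k l : rzero (phi k) l = root (orf_num alpha a k) l.
Proof.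
have [-> _] := phi_frac k; apply: rzero_frac => [|x /root_orf_num_lt1 x1].
  by rewrite -(tofrac_eq0 (pi_ _ _)) (rmorph_pi_neq0 f_varpi).
by apply: (@rmorph_pi_neq0 _ alpha _ (horner_eval x)) => i; apply: varpi_neq0_in.
Qed.

End Orf.

Lemma orf_num_char_poly (R : realType) (alpha a : nat -> R[i]) m :
  alpha 0%N = 0 -> (forall n, `|alpha n| < 1) -> (forall n, `|a n.+1| < 1) ->
  exists2 c, c != 0 & orf_num alpha a m.+1 = c *: char_poly (Umx alpha a m.+1).
Proof.
move=> alpha0 alpha_lt1 a_lt1.
have S0 := det_moebius_denom_neq0 alpha0 alpha_lt1 a_lt1 m.
have := @char_poly_Umx _ alpha a alpha_lt1 m.+1.
rewrite unitmxE unitfE => /(_ S0).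
rewrite det_pencil // mul_polyC; set k := cmv_const _ _ _ _ / _ => e.
have k0 : k != 0.
  apply: contraNneq S0 => k0; move/eqP: e; rewrite k0 scale0r.
  by rewrite scaler_eq0 (negbTE (monic_neq0 (char_poly_monic _))) orbF.
exists (k^-1 * \det (1%:M + diag_mx (row_of_nat m.+1 (fun k => (alpha k)^*))
                              *m principal (Cmx a) m.+1)).
  by rewrite mulf_neq0 ?invr_neq0.
by rewrite -scalerA e scalerA mulVf // scale1r.
Qed.

Theorem theorem5p8 (R : realType) (mu : probability (borel_circle R) R)
    (alpha a : nat -> R[i]) (phi : nat -> ratfun R) :
  infinite_set (mu_support mu) ->
  alpha 0%N = 0 -> (forall n, (0 < n)%N -> `|alpha n| < 1) ->
  is_ORF mu alpha phi a ->
  forall n : nat, (0 < n)%N ->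
  let U := Umx alpha a n in
  [/\ forall l : R[i], rzero (phi n) l <-> eigenvalue U l,
      forall l : R[i], eigenvalue U l -> \rank (eigenspace U l) = 1%N,
      forall l : R[i], rzero (phi n) l ->
        (forall x : 'rV[R[i]]_n,
           x *m U = l *: x <->
           exists c : R[i], x = c *: rveval (Xvec alpha phi n) l) /\
        (forall y : 'cV[R[i]]_n,
           U *m y = l *: y <->
           exists c : R[i], y = c *: (rveval (Yvec alpha phi n) l)^T)
    & exists2 p : {poly R[i]},
        phi n = polyf p / polyf (pi_ alpha n) &
        exists2 c : R[i], c != 0 & p = c *: char_poly U].
Proof.
move=> _ alpha0 alpha_pos_lt1 orf [//|m] _ U.
have alpha_lt1 k : `|alpha k| < 1.
  by case: k => [|k]; rewrite ?alpha0 ?normr0 ?ltr01 ?alpha_pos_lt1.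
have a_lt1 k : `|a k.+1| < 1 by apply: (ORF_param orf).
have [c c0 pE] := orf_num_char_poly m alpha0 alpha_lt1 a_lt1.
have rootE l : root (orf_num alpha a m.+1) l = eigenvalue U l.
  by rewrite eigenvalue_root_char pE rootZ.
have zeroE l : rzero (phi m.+1) l = root (orf_num alpha a m.+1) l.
  exact: (rzero_phi alpha_lt1 a_lt1 orf).
have leftP l (x : 'rV_m.+1) : root (orf_num alpha a m.+1) l ->
    x *m U = l *: x <-> exists c, x = c *: rveval (Xvec alpha phi m.+1) l.
  move=> rl; have l1 := root_orf_num_lt1 alpha_lt1 a_lt1 rl.
  apply: (left_eigenspaceP alpha0 alpha_lt1 a_lt1 l1 _ rl).
  by apply: (rveval_row alpha_lt1 orf l1) => j; apply: Xvec_entry.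
split=> [l|l|l|].
- by rewrite zeroE rootE.
- move=> el; have rl : root (orf_num alpha a m.+1) l by rewrite rootE.
  apply/eqP; rewrite eqn_leq lt0n mxrank_eq0 andbC; apply/andP; split=> //.
  apply: leq_trans (rank_leq_row (rveval (Xvec alpha phi m.+1) l)).
  apply/mxrankS/row_subP=> i.
  have /eigenspaceP/leftP-/(_ rl)[k ->] := row_sub i (eigenspace U l).
  exact: scalemx_sub.
- rewrite zeroE => rl; split=> [x|y]; first exact: leftP.
  have l1 := root_orf_num_lt1 alpha_lt1 a_lt1 rl.
  apply: (right_eigenspaceP alpha0 alpha_lt1 a_lt1 l1 _ rl).
  by apply: (rveval_row alpha_lt1 orf l1) => j; apply: Yvec_entry.
exists (orf_num alpha a m.+1); last by exists c.
by have [-> _] := phi_frac orf m.+1.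
Qed.
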